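(* There is an absolute constant $C_1>0$ such that, writing $C_{1,\beta}=2^{-1/2}C_1(\beta^{-1}+1)$ for $\beta>0$, the following holds for $d=1$. Let $\alpha,\beta>0$ satisfy $$C_{1,\beta}\,\alpha^{-1/2}<\Big(\frac{3}{16}\Big)^4,$$ and let $R_p>0$ be such that $$\frac16\le R_p\le\frac{\alpha^{1/8}}{2^3\sqrt[4]{C_{1,\beta}}}-\frac12.$$ Let $M(x,v)=e^{-\alpha|x|^2-\beta|v|^2}$. (a) If $f_0\in\mathcal{M}_{\alpha,\beta}$ satisfies $\|f_0-M\|_{\alpha,\beta}<R_p$, then there exists a unique mild solution $f$ of the 6-wave kinetic equation with initial data $f_0$ satisfying the bound $|||T^{-t}f(t)-M|||_{\alpha,\beta}\le 2R_p$. (b) Moreover, if $\frac{1}{2^{12}}<C_{1,\beta}\,\alpha^{-1/2}<\big(\frac{3}{16}\big)^4$, then the mild solution $f$ is non-negative.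
   Context: Here $d=1$, $t\in\mathbb{R}$, $x,v\in\mathbb{R}^d$. ''Measurable'' means Borel measurable; functions of $(t,x,v)$ are jointly measurable. Spaces. $\mathcal{M}_{\alpha,\beta}$ is the space of measurable $g:\mathbb{R}^d\times\mathbb{R}^d\to\mathbb{R}$ with $\|g\|_{\alpha,\beta}:=\sup_{x,v}|g(x,v)|e^{\alpha|x|^2+\beta|v|^2}<\infty$. $L^\infty(\mathbb{R},\mathcal{M}_{\alpha,\beta})$ is the space of time-dependent functions $g(t,x,v)$ with $|||g|||_{\alpha,\beta}:=\sup_{t\in\mathbb{R}}\|g(t)\|_{\alpha,\beta}<\infty$. Transport. $(T^sg)(t,x,v):=g(t,x-sv,v)$. So $T^{-t}f(t)$ is the function $(x,v)\mapsto f(t,x+tv,v)$, and $T^{-s}\mathcal{C}_6[f](s,x,v)=\mathcal{C}_6[f](s,x+sv,v)$. The notation $|||T^{-t}f(t)-M|||_{\alpha,\beta}$ means $\sup_{t\in\mathbb{R}}\|T^{-t}f(t)-M\|_{\alpha,\beta}$. Equation. The 6-wave kinetic equation with initial data $f_0$ is $\partial_tf+v\cdot\nabla_xf=\mathcal{C}_6[f]$, $f(t=0)=f_0$, where $$\mathcal{C}_6[f](t,x,v)=\int_{\mathbb{R}^{5d}}\delta(\Sigma)\delta(\Omega)\Big[f_3f_4f_5(ff_1+ff_2+f_1f_2)-ff_1f_2(f_3f_4+f_3f_5+f_4f_5)\Big]dv_1\cdots dv_5,$$ $f=f(t,x,v)$, $f_i=f(t,x,v_i)$, $\Sigma=v+v_1+v_2-v_3-v_4-v_5$,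 $\Omega=|v|^2+|v_1|^2+|v_2|^2-|v_3|^2-|v_4|^2-|v_5|^2$. Meaning of the deltas: $\delta(\Sigma)$ sets $v_5=v+v_1+v_2-v_3-v_4$; then, for fixed $v,v_1,v_2$, with $h(v_3,v_4)$ denoting $\Omega$ after this substitution, $\int_{\mathbb{R}^{2d}}\delta(h)F\,dv_3dv_4:=\int_{\{h=0\}}\frac{F}{|\nabla h|}\,d\mathcal{H}^{2d-1}$ (surface measure on the zero set of $h$ in $\mathbb{R}^{2d}$). Mild solution. For $f_0\in\mathcal{M}_{\alpha,\beta}$, a measurable $f:\mathbb{R}\times\mathbb{R}^d\times\mathbb{R}^d\to\mathbb{R}$ is a mild solution with initial data $f_0$ if $T^{-t}f(t)\in L^\infty(\mathbb{R},\mathcal{M}_{\alpha,\beta})$ and $T^{-t}f(t,x,v)=f_0(x,v)+\int_0^tT^{-s}\mathcal{C}_6[f](s,x,v)\,ds$ for all $t\in\mathbb{R}$. *)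

(* Defs.v *)
From HB Require Import structures.
From mathcomp Require Import all_boot all_order all_algebra.
From mathcomp Require Import all_classical all_reals all_analysis.
Import Order.TTheory GRing.Theory Num.Theory.
Import numFieldNormedType.Exports.

Set Implicit Arguments.
Unset Strict Implicit.
Unset Printing Implicit Defensive.

Local Open Scope classical_set_scope.
Local Open Scope ring_scope.

(* One-dimensional Hausdorff measure on the Euclidean plane. The product
   [R * R] carries the sup norm in the library, hence the explicit Euclidean
   distance; no normalizing constant is needed in dimension one. *)
Section hausdorff_outer_measure.
Context {R : realType}.
Implicit Types (A : set (R * R)) (F : (set (R * R))^nat).
Local Open Scope ereal_scope.

Definition edist (p q : R * R) : R :=
  Num.sqrt ((p.1 - q.1) ^+ 2 + (p.2 - q.2) ^+ 2)%R.

(* [0] is added because the supremum of the empty set is [-oo]. *)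
Definition ediam A : \bar R :=
  ereal_sup (0 |` [set (edist pq.1 pq.2)%:E | pq in A `*` A]).

Definition delta_cover (delta : R) A : set ((set (R * R))^nat) :=
  [set F | A `<=` \bigcup_k F k /\ forall k, ediam (F k) <= delta%:E].

Definition hausdorff1_delta (delta : R) A : \bar R :=
  ereal_inf [set \sum_(k <oo) ediam (F k) | F in delta_cover delta A].

Definition hausdorff1 A : \bar R :=
  ereal_sup [set hausdorff1_delta delta A | delta in [set delta | (0 < delta)%R]].

Lemma ediam_ge0 A : 0 <= ediam A.
Proof. by apply: ereal_sup_ubound; left. Qed.

Lemma ediam0 : ediam set0 = 0.
Proof.
apply/eqP; rewrite eq_le ediam_ge0 andbT.
by apply: ge_ereal_sup => _ [->//|[pq [[]]]].
Qed.

Lemma le_hausdorff1_delta delta :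
  {homo hausdorff1_delta delta : A B / A `<=` B >-> A <= B}.
Proof.
move=> A B AB; apply/ereal_inf_le_tmp => x [F [BF dF] <-].
by exists F => //; split => //; exact: subset_trans AB BF.
Qed.

Lemma hausdorff1_delta_ge0 delta A : 0 <= hausdorff1_delta delta A.
Proof.
apply: le_ereal_inf_tmp => x [F _ <-].
by apply: nneseries_ge0 => *; exact: ediam_ge0.
Qed.

Lemma hausdorff1_delta0 delta : (0 < delta)%R ->
  hausdorff1_delta delta set0 = 0.
Proof.
move=> d0; apply/eqP; rewrite eq_le hausdorff1_delta_ge0 andbT.
apply: ereal_inf_lbound; exists (fun=> set0).
  by split => // k; rewrite ediam0 lee_fin ltW.
by apply: eseries0 => *; rewrite ediam0.
Qed.

Lemma hausdorff1_delta_sigma_subadditive delta :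
  sigma_subadditive (hausdorff1_delta delta).
Proof.
move=> A.
have [[i ioo]|] := pselect (exists i, hausdorff1_delta delta (A i) = +oo).
  rewrite (eseries_pinfty _ _ ioo) ?leey// => n _.
  by rewrite -ltNye (lt_le_trans _ (hausdorff1_delta_ge0 _ _)).
rewrite -forallNE => Aoo.
suff add2e (e : {posnum R}) : hausdorff1_delta delta (\bigcup_n A n) <=
    \sum_(i <oo) hausdorff1_delta delta (A i) + e%:num%:E.
  by apply/lee_addgt0Pr => _/posnumP[].
rewrite (le_trans _ (epsilon_trick _ _ _))//; last first.
  by move=> n; exact: hausdorff1_delta_ge0.
pose P n (B : (set (R * R))^nat) := delta_cover delta (A n) B /\
  \sum_(k <oo) ediam (B k) <=
    hausdorff1_delta delta (A n) + (e%:num / (2 ^ n.+1)%:R)%:E.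
have [G PG] : {G : ((set (R * R))^nat)^nat & forall n, P n (G n)}.
  apply: (@choice _ _ P) => n.
  have dfin : hausdorff1_delta delta (A n) \is a fin_num.
    by rewrite ge0_fin_numE ?hausdorff1_delta_ge0// lt_neqAle leey andbT; exact/eqP/Aoo.
  have en1 : (0 < e%:num / (2 ^ n.+1)%:R)%R by [].
  have [_ [B AB <-] Bs] := lb_ereal_inf_adherent en1 dfin.
  by exists B; split => //; exact/ltW.
have G_ge0 x : 0 <= (ediam \o uncurry G) x by exact: ediam_ge0.
apply: (@le_trans _ _ (\esum_(i in setT) (ediam \o uncurry G) i)).
  apply: ereal_inf_lbound => /=.
  have /card_esym/ppcard_eqP[f] := card_nat2.
  exists (uncurry G \o f).
    split => [t [i _ /(PG i).1.1 [j _ Gt]]|k].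
      by exists (f^-1%FUN (i, j)) => //=; rewrite invK ?inE.
    by rewrite /=; case: (f k) => i j; exact: (PG i).1.2.
  rewrite -(esum_pred_image (ediam \o uncurry G) _ xpredT) ?[fun=> _]set_true//.
  by rewrite image_eq.
rewrite (_ : esum _ _ = \sum_(i <oo) \sum_(j <oo) ediam (G i j)); last first.
  pose J : nat -> set (nat * nat) := fun i => [set (i, j) | j in setT].
  rewrite (_ : setT = \bigcup_k J k); last first.
    by rewrite predeqE => -[a b]; split => // _; exists a => //; exists b.
  rewrite esum_bigcupT /=; last 2 first.
    - apply/trivIsetP => i j _ _ ij.
      rewrite predeqE => -[n m] /=; split => //= -[] [_] _ [<-{n} _].
      by move=> [m' _] [] /esym/eqP; rewrite (negbTE ij).
    - by move=> *; exact: ediam_ge0.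
  rewrite -(image_id [set: nat]) -fun_true esum_pred_image//; last first.
    by move=> n _; apply: esum_ge0 => *; exact: ediam_ge0.
  apply: eq_eseriesr => /= j _.
  rewrite -(esum_pred_image (ediam \o uncurry G) (pair j) predT)/=; last 2 first.
    - by move=> *; exact: ediam_ge0.
    - by move=> ? ? _ _; exact: (@can_inj _ _ _ snd).
  by congr esum; rewrite predeqE => -[a b]; split; move=> [i _ <-]; exists i.
apply: lee_nneseries => i _; last exact: (PG i).2.
by move=> *; apply: nneseries_ge0 => *; exact: ediam_ge0.
Qed.

Lemma hausdorff1_ge0 A : 0 <= hausdorff1 A.
Proof.
apply: le_trans (hausdorff1_delta_ge0 1 A) _.
by apply: ereal_sup_ubound; exists 1%R => //=.
Qed.

Lemma hausdorff10 : hausdorff1 set0 = 0.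
Proof.
apply/eqP; rewrite eq_le hausdorff1_ge0 andbT.
by apply: ge_ereal_sup => _ [d d0 <-]; rewrite hausdorff1_delta0.
Qed.

Lemma le_hausdorff1 : {homo hausdorff1 : A B / A `<=` B >-> A <= B}.
Proof.
move=> A B AB; apply: ge_ereal_sup => _ [d d0 <-].
apply: le_trans (le_hausdorff1_delta d AB) _.
by apply: ereal_sup_ubound; exists d.
Qed.

Lemma hausdorff1_sigma_subadditive : sigma_subadditive hausdorff1.
Proof.
move=> A; apply: ge_ereal_sup => _ [d d0 <-].
apply: le_trans (hausdorff1_delta_sigma_subadditive d A) _.
apply: lee_nneseries => [*|i _]; first exact: hausdorff1_delta_ge0.
by apply: ereal_sup_ubound; exists d.
Qed.

HB.instance Definition _ := isOuterMeasure.Build R (R * R)%type hausdorff1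
  hausdorff10 hausdorff1_ge0 le_hausdorff1 hausdorff1_sigma_subadditive.

End hausdorff_outer_measure.

(* Hausdorff measure as a measure on its Caratheodory sigma-algebra, which
   contains the Borel sets since [hausdorff1] is a metric outer measure. *)
Definition curve_measure {R : realType} :
  set (caratheodory_type (@hausdorff1 R)) -> \bar R := hausdorff1.
HB.instance Definition _ (R : realType) :=
  isMeasure.Build _ _ _ (@curve_measure R)
    (@caratheodory_measure0 R _ (@hausdorff1 R))
    (@caratheodory_measure_ge0 R _ (@hausdorff1 R))
    (@caratheodory_measure_sigma_additive R _ (@hausdorff1 R)).

Section wave_kinetic.
Context {R : realType}.
Local Notation leb := (@lebesgue_measure R).

Definition wnorm (alpha beta : R) (g : R -> R -> R) : \bar R :=
  ereal_sup [set (`|g xv.1 xv.2|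
    * expR (alpha * `|xv.1| ^+ 2 + beta * `|xv.2| ^+ 2))%:E
    | xv in [set: R * R]].

Definition in_M (alpha beta : R) (g : R -> R -> R) : Prop :=
  measurable_fun [set: R * R] (fun xv => g xv.1 xv.2) /\
  (wnorm alpha beta g < +oo)%E.

Definition wnorm_sup (alpha beta : R) (g : R -> R -> R -> R) : \bar R :=
  ereal_sup [set wnorm alpha beta (g t) | t in [set: R]].

Definition measurable3 (g : R -> R -> R -> R) : Prop :=
  measurable_fun [set: R * R * R] (fun p => g p.1.1 p.1.2 p.2).

Definition in_Linfty_M (alpha beta : R) (g : R -> R -> R -> R) : Prop :=
  measurable3 g /\ (wnorm_sup alpha beta g < +oo)%E.

Definition transport (s : R) (g : R -> R -> R -> R) : R -> R -> R -> R :=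
  fun t x v => g t (x - s * v) v.

(* The time-dependent function [T^{-t} f(t)]. *)
Definition free_profile (f : R -> R -> R -> R) : R -> R -> R -> R :=
  fun t => transport (- t) f t.

(* [Omega] as a function of [p = (v3, v4)] once
   [v5 = v + v1 + v2 - v3 - v4]. *)
Definition resonance (v v1 v2 : R) (p : R * R) : R :=
  `|v| ^+ 2 + `|v1| ^+ 2 + `|v2| ^+ 2
  - `|p.1| ^+ 2 - `|p.2| ^+ 2 - `|v + v1 + v2 - p.1 - p.2| ^+ 2.

Definition grad_norm (h : R * R -> R) (p : R * R) : R :=
  Num.sqrt ((derive1 (fun y => h (y, p.2)) p.1) ^+ 2
          + (derive1 (fun y => h (p.1, y)) p.2) ^+ 2).

(* [int delta(h) F dv3 dv4] *)
Definition delta_integral (h F : R * R -> R) : R :=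
  \int[curve_measure]_(p in [set p | h p = 0]) (F p / grad_norm h p).

Definition interaction (y y1 y2 y3 y4 y5 : R) : R :=
  y3 * y4 * y5 * (y * y1 + y * y2 + y1 * y2)
  - y * y1 * y2 * (y3 * y4 + y3 * y5 + y4 * y5).

(* The integrals below are total: they take a junk value when they diverge.
   When the free profile of [f] is in the space [in_Linfty_M alpha beta] with
   [alpha, beta > 0], they converge absolutely at every [(t, x, v)]. *)
Definition collision6 (f : R -> R -> R -> R) (t x v : R) : R :=
  \int[(leb \x leb)%E]_(w in [set: R * R])
    delta_integral (resonance v w.1 w.2) (fun p =>
      interaction (f t x v) (f t x w.1) (f t x w.2)
        (f t x p.1) (f t x p.2) (f t x (v + w.1 + w.2 - p.1 - p.2))).

Definition oriented_integral (a b : R) (g : R -> R) : R :=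
  if a <= b then \int[leb]_(s in `[a, b]) g s
  else - \int[leb]_(s in `[b, a]) g s.

Definition mild_solution (alpha beta : R) (f0 : R -> R -> R)
    (f : R -> R -> R -> R) : Prop :=
  [/\ measurable3 f,
      in_Linfty_M alpha beta (free_profile f) &
      forall t x v, free_profile f t x v = f0 x v
        + oriented_integral 0 t (fun s => transport (- s) (collision6 f) s x v)].

Definition maxwellian (alpha beta : R) (x v : R) : R :=
  expR (- alpha * `|x| ^+ 2 - beta * `|v| ^+ 2).

Definition C1_beta (C1 beta : R) : R := 2 `^ (- 2^-1) * C1 * (beta^-1 + 1).

End wave_kinetic.

(* Main.v *)
(* Along free transport the equation reads [f = duhamel f0 f], and the solution
   is the fixed point of this map on the ball of radius [2 Rp] around the
   Maxwellian in the weighted sup norm.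

   On the resonant set the weight [exp (- alpha (x - t v)^2 - beta v^2)]
   satisfies [w3 w4 w5 = w w1 w2] by conservation of momentum and energy, so
   each of the six quintic terms of the interaction is at most [F^5 w w1 w2].
   Integrating [w1 w2] over the plane gives [w pi / (beta + alpha t^2)], whose
   time integral is at most [w pi^2 / sqrt (alpha beta)], uniformly in [t].

   The resonant set is the image of a fixed ellipse under a similarity of ratio
   [r = r(v, v1, v2)]. Since [H^1] scales by [r] and so does the gradient of the
   resonance function, the delta integral is an integral over that ellipse, with
   a bounded density, against a fixed finite measure. This makes it measurable
   in the parameters, without any area formula.

   When [C_1beta alpha^(-1/2) > 2^-12] one gets [2 Rp <= 1], hence
   [f >= (1 - 2 Rp) w >= 0]. *)
Require Import Defs.
From HB Require Import structures.
From mathcomp Require Import all_boot all_order all_algebra.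
From mathcomp Require Import all_classical all_reals all_analysis.
From mathcomp Require Import measurable_realfun ring lra.
Import Order.TTheory GRing.Theory Num.Theory.
Import numFieldNormedType.Exports.
Set Implicit Arguments.
Unset Strict Implicit.
Unset Printing Implicit Defensive.
Local Open Scope classical_set_scope.
Local Open Scope ring_scope.

(* [all_analysis] exports another [edist]. *)
Local Notation edist := Defs.edist.

(** * Borel sets are Hausdorff measurable *)

Section hausdorff.
Context {R : realType}.
Implicit Types (A B X : set (R * R)) (p q : R * R).
Local Notation H1 := (@hausdorff1 R).
Local Open Scope ereal_scope.

Lemma edist_le_ediam A p q : A p -> A q -> (edist p q)%:E <= ediam A.
Proof. by move=> Ap Aq; apply: ereal_sup_ubound; right; exists (p, q). Qed.

Lemma ediam_le A (c : \bar R) : 0 <= c ->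
  (forall p q, A p -> A q -> (edist p q)%:E <= c) -> ediam A <= c.
Proof.
move=> c0 Ac; apply: ge_ereal_sup => _ [->//|[[p q] [/= Ap Aq] <-]].
exact: Ac.
Qed.

Lemma hausdorff1_delta_le (d : R) A : (0 < d)%R ->
  hausdorff1_delta d A <= H1 A.
Proof. by move=> d0; apply: ereal_sup_ubound; exists d. Qed.

(** The sets of a [d / K]-cover of the image, pulled back to [A], have diameters at most [K] times
    larger and form a [d]-cover of [A]. *)
Lemma hausdorff1_le_image (K : R) (phi : R * R -> R * R) A : (0 < K)%R ->
  (forall p q, A p -> A q -> (edist p q <= K * edist (phi p) (phi q))%R) ->
  H1 A <= K%:E * H1 (phi @` A).
Proof.
move=> K0 lip; apply: ge_ereal_sup => _ [d /= d0 <-].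
apply: (@le_trans _ _ (K%:E * hausdorff1_delta (d / K) (phi @` A))); last first.
  by rewrite lee_pmul2l ?fin_numE// hausdorff1_delta_le// divr_gt0.
rewrite -lee_pdivrMl//; apply: le_ereal_inf_tmp => _ [F [AF dF] <-].
rewrite lee_pdivrMl//.
pose G k := A `&` phi @^-1` F k.
have dG k : ediam (G k) <= K%:E * ediam (F k).
  apply: ediam_le => [|p q [Ap Fp] [Aq Fq]].
    by rewrite mule_ge0 ?ediam_ge0// lee_fin ltW.
  apply: (@le_trans _ _ (K%:E * (edist (phi p) (phi q))%:E)).
    by rewrite -EFinM lee_fin lip.
  by rewrite lee_pmul2l ?fin_numE// edist_le_ediam.
apply: (@le_trans _ _ (\sum_(k <oo) ediam (G k))).
  apply: ereal_inf_lbound; exists G => //; split.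
    move=> p Ap; have [|k _ Fp] := AF (phi p); first by exists p.
    by exists k.
  move=> k; apply: (le_trans (dG k)).
  apply: (@le_trans _ _ (K%:E * (d / K)%:E)); last first.
    by rewrite -EFinM mulrCA mulfV ?mulr1// gt_eqF.
  by rewrite lee_pmul2l ?fin_numE.
rewrite -nneseriesZl; last by move=> *; exact: ediam_ge0.
by apply: lee_nneseries => *; [exact: ediam_ge0|exact: dG].
Qed.

(** A set of diameter below [e] cannot meet both [A] and [B], so a fine enough cover of the union
    splits into a cover of each. *)
Lemma hausdorff1_separated (e : R) A B : (0 < e)%R ->
  (forall p q, A p -> B q -> (e <= edist p q)%R) ->
  H1 A + H1 B <= H1 (A `|` B).
Proof.
move=> e0 sep.
have key d : (0 < d)%R -> (d < e)%R ->
    hausdorff1_delta d A + hausdorff1_delta d B <= H1 (A `|` B).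
  move=> d0 de; apply: le_trans (hausdorff1_delta_le _ d0).
  apply: le_ereal_inf_tmp => _ [F [ABF dF] <-].
  pose FA k := if `[< F k `&` A !=set0 >] then F k else set0.
  pose FB k := if `[< F k `&` A !=set0 >] then set0 else F k.
  have nFB k p q : F k p -> F k q -> A p -> B q -> False.
    move=> Fp Fq Ap Bq; have := edist_le_ediam Fp Fq.
    move=> /le_trans/(_ (dF k)); rewrite lee_fin => /(le_trans (sep _ _ Ap Bq)).
    by rewrite leNgt de.
  have sub (G : nat -> set (R * R)) (P : nat -> bool) C :
      C `<=` \bigcup_k G k -> (forall k, G k = if P k then F k else set0) ->
      hausdorff1_delta d C <= \sum_(k <oo) ediam (G k).
    move=> CG GE; apply: ereal_inf_lbound; exists G => //; split=> // k.
    by rewrite GE; case: (P k) => //; rewrite ediam0 lee_fin ltW.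
  apply: (@le_trans _ _ (\sum_(k <oo) ediam (FA k) + \sum_(k <oo) ediam (FB k))).
    apply: leeD.
      apply: (sub FA (fun k => `[< F k `&` A !=set0 >])) => //.
      move=> p Ap; have [k _ Fp] := ABF p (or_introl Ap); exists k => //.
      by rewrite /FA ifT//; apply/asboolP; exists p.
    apply: (sub FB (fun k => ~~ `[< F k `&` A !=set0 >])) => //.
      move=> q Bq; have [k _ Fq] := ABF q (or_intror Bq); exists k => //.
      rewrite /FB ifF//; apply/asboolPn => -[p [Fp Ap]].
      exact: nFB Fp Fq Ap Bq.
    by move=> k; rewrite /FB; case: asbool.
  rewrite -nneseriesD; [|by move=> *; exact: ediam_ge0..].
  apply: lee_nneseries => [*|k _].
    by rewrite adde_ge0// ediam_ge0.
  by rewrite /FA /FB; case: asbool; rewrite ediam0 ?adde0 ?add0e.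
have [->|ABoo] := eqVneq (H1 (A `|` B)) +oo; first exact: leey.
have fAB : H1 (A `|` B) \is a fin_num.
  by rewrite ge0_fin_numE ?hausdorff1_ge0// lt_neqAle ABoo leey.
have fin C : C `<=` A `|` B -> H1 C \is a fin_num.
  move=> CAB; rewrite ge0_fin_numE ?hausdorff1_ge0//.
  by rewrite (le_lt_trans (le_hausdorff1 CAB))// -ge0_fin_numE ?hausdorff1_ge0.
have fA : H1 A \is a fin_num by apply: fin => ?; left.
have fB : H1 B \is a fin_num by apply: fin => ?; right.
rewrite -leeBrDr//; apply: ge_ereal_sup => _ [d1 /= d10 <-].
rewrite leeBrDr// addrC -leeBrDr; last first.
  rewrite ge0_fin_numE ?hausdorff1_delta_ge0//.
  by rewrite (le_lt_trans (hausdorff1_delta_le _ d10))// -ge0_fin_numE// hausdorff1_ge0.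
apply: ge_ereal_sup => _ [d2 /= d20 <-].
rewrite leeBrDr; last first.
  rewrite ge0_fin_numE ?hausdorff1_delta_ge0//.
  by rewrite (le_lt_trans (hausdorff1_delta_le _ d10))// -ge0_fin_numE// hausdorff1_ge0.
(* [H1 A] and [H1 B] are suprema over separate scales [d1] and [d2]. A common smaller scale below
   [e] dominates both, since [hausdorff1_delta] grows as the scale shrinks. *)
pose d := (Num.min (Num.min d1 d2) (e / 2))%R.
have d0 : (0 < d)%R by rewrite /d !lt_min d10 d20 divr_gt0.
have de : (d < e)%R.
  by rewrite /d gt_min; apply/orP; right; rewrite ltr_pdivrMr// ltr_pMr// ltr1n.
have mono C d' : (d <= d')%R -> hausdorff1_delta d' C <= hausdorff1_delta d C.
  move=> dd'; apply: ereal_inf_le_tmp => x [F [CF dF] <-]; exists F => //.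
  by split => // k; apply: le_trans (dF k) _; rewrite lee_fin.
rewrite addrC; apply: le_trans (key d d0 de); apply: leeD; apply: mono;
  by rewrite /d !ge_min lexx ?orbT.
Qed.

(** Caratheodory's argument for metric outer measures: cutting [X] at levels [d k] decreasing to [c]
    gives sets [XU k] at positive distance from the complement of [U], and the measure lost between
    [XU k] and [X] inside [U] is at most the tail of a convergent series of shells. *)
Lemma caratheodory_superlevel (u : R * R -> R) (c : R) :
  (forall p q, (u p - u q <= edist p q)%R) ->
  hausdorff1.-caratheodory [set p | (c < u p)%R].
Proof.
move=> lip; apply: le_caratheodory_measurable => X; set U := [set p | _].
change (H1 (X `&` U) + H1 (X `&` ~` U) <= H1 X).
have [->|Xoo] := eqVneq (hausdorff1 X) +oo; first exact: leey.
have finX C : C `<=` X -> H1 C \is a fin_num.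
  move=> CX; rewrite ge0_fin_numE ?hausdorff1_ge0//.
  by rewrite (le_lt_trans (le_hausdorff1 CX))// lt_neqAle Xoo leey.
pose d k : R := (c + k.+1%:R^-1)%R.
have ltd m n : (m < n)%N -> (d n < d m)%R.
  by move=> mn; rewrite ltrD2l ltf_pV2 ?posrE// ltr_nat.
have led m n : (m <= n)%N -> (d n <= d m)%R.
  by move=> mn; rewrite lerD2l lef_pV2 ?posrE// ler_nat.
have cd k : (c < d k)%R by rewrite ltrDl.
pose XU k := X `&` [set p | d k < u p]%R.
pose g k := fine (H1 (XU k)).
have gE k : H1 (XU k) = (g k)%:E by rewrite fineK// finX// => p [].
have g_nd m n : (m <= n)%N -> (g m <= g n)%R.
  move=> mn; rewrite -lee_fin -!gE; apply: le_hausdorff1 => p [Xp /= up].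
  by split => //=; exact: le_lt_trans (led _ _ mn) up.
have g_ub k : (g k <= fine (H1 X))%R.
  rewrite -lee_fin -gE fineK ?finX//.
  by apply: le_hausdorff1 => p [].
pose L := sup (range g).
have supg : has_sup (range g).
  by split; [exists (g 0%N), 0%N|exists (fine (H1 X)) => _ [k _ <-]].
have gL k : (g k <= L)%R by apply: sup_ubound; [case: supg|exists k].
pose S k := X `&` [set p | d k.+2 < u p <= d k.+1]%R.
have sepS k A B (a b : R) : (b < a)%R -> (forall p, A p -> a < u p)%R ->
    (forall p, B p -> u p <= b)%R -> A `|` B `<=` XU k -> H1 A + H1 B <= (g k)%:E.
  move=> ab ua ub ABk; rewrite -gE.
  apply: le_trans (le_hausdorff1 ABk).
  apply: (@hausdorff1_separated (a - b)%R); first by rewrite subr_gt0.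
  by move=> p q /ua ap /ub qb; apply: le_trans (lip p q); lra.
(* The shells [S k] and the sets [XU k] are separated, so the sum of the
   [H1 (S k)] telescopes. *)
have HS k : H1 (S k) <= (g k.+2 - g k)%:E.
  rewrite EFinB leeBrDr// addeC -gE; apply: (sepS _ _ _ (d k) (d k.+1)) => //.
  - exact: ltd.
  - by move=> p [].
  - by move=> p [_ /= /andP[]].
  - move=> p [[Xp /= up]|[Xp /= /andP[up _]]]; split => //=.
    by apply: lt_trans up; exact: ltd.
(* The two-step differences split into two telescoping sums, each at most [L - g n]. *)
have tail n : \sum_(n <= k <oo) H1 (S k) <= (2 * (L - g n))%:E.
  apply: lime_le.
    by apply: is_cvg_nneseries => *; exact: hausdorff1_ge0.
  apply: nearW => N.
  apply: (@le_trans _ _ (\sum_(n <= k < N) (g k.+2 - g k)%:E)).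
    by apply: lee_sum => *; exact: HS.
  rewrite sumEFin lee_fin; have [nN|Nn] := leqP n N; last first.
    by rewrite big_geq ?(ltnW Nn)// mulr_ge0// subr_ge0.
  rewrite (eq_bigr (fun k => (g k.+2 - g k.+1) + (g k.+1 - g k))%R); last first.
    by move=> k _; ring.
  rewrite big_split/= (telescope_sumr (fun k => g k.+1))// telescope_sumr//.
  by have := gL N.+1; have := gL N; have := g_nd _ _ (leqnSn n); lra.
have XUle n : H1 (X `&` U) <= (g n.+1)%:E + (2 * (L - g n))%:E.
  apply: (@le_trans _ _ (H1 (XU n.+1 `|` \bigcup_(k in ~` `I_n) S k))).
    apply: le_hausdorff1 => p [Xp /= Up].
    have [up|up] := ltrP (d n.+1) (u p); first by left.
    right.
    have [k dk] : exists k, (d k < u p)%R.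
      exists (Num.bound (u p - c)^-1); rewrite -ltrBrDl.
      rewrite invf_plt ?posrE ?subr_gt0//.
      apply: lt_trans (archi_boundP _) _; first by rewrite invr_ge0 subr_ge0 ltW.
      by rewrite ltr_nat.
    (* The least [m] with [d m < u p] puts [p] in the shell of index [m - 2]; since [m] exceeds
       [n.+1], that shell belongs to the tail from [n]. *)
    case: (ex_minnP (ex_intro (fun k => d k < u p)%R k dk)) => m dm mmin.
    have nm : (n.+1 < m)%N.
      by rewrite ltnNge; apply: contraL up => /led mn; rewrite -ltNge (le_lt_trans mn).
    case: m nm dm mmin => [//|[//|m]] nm dm mmin.
    exists m; first by apply/negP; rewrite /= -leqNgt -ltnS.
    split=> //=; rewrite dm/= leNgt; apply/negP => /mmin.
    by rewrite ltnn.
  apply: le_trans (outer_measureU2 _ _ _) _.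
  apply: leeD; first by rewrite -gE.
  apply: le_trans (tail n).
  exact: outer_measure_sigma_subadditive_tail.
apply/lee_addgt0Pr => e e0.
(* Half of [e], because the tail bound is twice [L - g n]. *)
have [_ [n _ <-] nL] := sup_adherent (divr_gt0 e0 (ltr0Sn R 1)) supg.
apply: (@le_trans _ _ ((g n.+1)%:E + (2 * (L - g n))%:E + H1 (X `&` ~` U))).
  exact: leeD2r.
rewrite addeAC; apply: leeD; last first.
  by rewrite lee_fin; move: nL; rewrite -/L; lra.
rewrite -gE; apply: le_trans (hausdorff1_separated (e := d n.+1 - c) _ _) _.
- by rewrite subr_gt0.
- move=> p q [_ /= up] [_ /= /negP]; rewrite -leNgt => uq.
  by apply: le_trans (lip p q); lra.
- by apply: le_hausdorff1 => p [[]|[]].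
Qed.
End hausdorff.

(** * Scaling of the Hausdorff measure and length of the ellipse *)

Section curves.
Context {R : realType}.
Implicit Types (A B X : set (R * R)) (p q w : R * R).
Local Notation H1 := (@hausdorff1 R).

(** The identity between two sigma-algebras, Caratheodory on the source and Borel on the target: its
    measurability says that Borel sets are Caratheodory measurable. *)
Definition borel_point : caratheodory_type H1 -> R * R := id.

(** The coordinates are 1-Lipschitz for [edist], so their superlevel sets are Caratheodory
    measurable, and these generate the Borel sets. *)
Lemma measurable_borel_point : measurable_fun setT borel_point.
Proof.
have sup1 (u : R * R -> R) : (forall p q, u p - u q <= edist p q) ->
    measurable_fun setT (u \o borel_point).
  move=> lip; apply: (measurability _ (RGenOInfty.measurableE R)).
  move=> _ [_ [c ->] <-]; rewrite setTI.
  rewrite (_ : _ @^-1` _ = [set p | c < u p]); first exact: caratheodory_superlevel.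
  by apply/seteqP; split => p /=; rewrite in_itv/= andbT.
have sq (x y : R) : x <= Num.sqrt (x ^+ 2 + y ^+ 2).
  apply: le_trans (ler_norm x) _; rewrite -sqrtr_sqr ler_sqrt ?addr_ge0 ?sqr_ge0//.
  by rewrite lerDl sqr_ge0.
apply/measurable_fun_pairP; split; apply: sup1 => p q; first exact: sq.
by rewrite /edist [X in Num.sqrt X]addrC; exact: sq.
Qed.

(** The same set function, made a measure on the Borel sets, the sigma-algebra used for functions of
    the velocities. *)
Definition curve_borel : set (R * R) -> \bar R := hausdorff1.

Let curve_borel_sigma_additive : semi_sigma_additive curve_borel.
Proof.
have cara A : measurable A -> measurable (A : set (caratheodory_type H1)).
  by move=> mA; have := measurable_borel_point measurableT mA; rewrite setTI.
move=> F mF tF mUF; apply: (@measure_semi_sigma_additive _ _ _ curve_measure) => //.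
- by move=> n; exact/cara.
- exact/cara.
Qed.

HB.instance Definition _ := isMeasure.Build _ _ _ curve_borel
  (hausdorff10 : curve_borel set0 = 0) hausdorff1_ge0 curve_borel_sigma_additive.

Lemma ge0_integral_curve_borel (D : set (R * R)) (f : R * R -> \bar R) :
  measurable D -> measurable_fun D f -> (forall p, 0 <= f p)%E ->
  (\int[curve_measure]_(p in D) f p = \int[curve_borel]_(p in D) f p)%E.
Proof.
move=> mD mf f0.
transitivity (\int[pushforward curve_measure borel_point]_(p in D) f p)%E.
  by rewrite (ge0_integral_pushforward measurable_borel_point)// => p _; exact: f0.
apply: eq_measure_integral => [|A mA AD]; first exact: measurable_borel_point.
reflexivity.
Qed.

Definition similarity (c r : R) (w : R * R) : R * R := (c + r * w.1, c + r * w.2).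

Lemma edist_similarity c r p q : 0 < r ->
  edist (similarity c r p) (similarity c r q) = r * edist p q.
Proof.
move=> r0; rewrite /edist/=.
rewrite (_ : _ + _ = r ^+ 2 * ((p.1 - q.1) ^+ 2 + (p.2 - q.2) ^+ 2)); last by ring.
by rewrite sqrtrM ?sqr_ge0// sqrtr_sqr gtr0_norm.
Qed.

Lemma measurable_similarity c r : measurable_fun setT (similarity c r).
Proof.
by apply/measurable_fun_pairP; split; apply: measurable_funD => //;
  apply: measurable_funM.
Qed.

Lemma similarityK c r : 0 < r ->
  cancel (fun p => ((p.1 - c) / r, (p.2 - c) / r)) (similarity c r).
Proof.
move=> r0 [a b]; rewrite /similarity/=.
by congr pair; rewrite mulrC divfK ?gt_eqF// subrKC.
Qed.

(** Both inequalities come from [hausdorff1_le_image]: the similarity multiplies distances by [r],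
    and its inverse by [r^-1]. *)
Lemma curve_borel_similarity c r A : 0 < r ->
  curve_borel A = (r%:E * pushforward curve_borel (similarity c r) A)%E.
Proof.
move=> r0; rewrite /pushforward /curve_borel.
have imA : similarity c r @` (similarity c r @^-1` A) = A.
  apply/seteqP; split=> [_ [w Aw <-]//|p Ap].
  by exists ((p.1 - c) / r, (p.2 - c) / r); rewrite /= similarityK.
apply/eqP; rewrite eq_le; apply/andP; split; last first.
  rewrite -lee_pdivlMl// -{2}imA; apply: hausdorff1_le_image.
    by rewrite invr_gt0.
  by move=> p q _ _; rewrite edist_similarity// mulKf ?gt_eqF.
pose psi p : R * R := ((p.1 - c) / r, (p.2 - c) / r).
have -> : similarity c r @^-1` A = psi @` A.
  rewrite -{2}imA; apply/seteqP; split=> [w Aw|_ [_ [w Aw <-] <-]].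
    exists (similarity c r w); first by exists w.
    case: (w) => a b; rewrite /psi /similarity/= !(addrC c) !addrK !(mulrC r).
    by rewrite !mulfK ?gt_eqF.
  by rewrite /psi/= !(addrC c) !addrK !(mulrC r) !mulfK ?gt_eqF//; case: (w) Aw.
apply: hausdorff1_le_image => // p q _ _.
by rewrite -(edist_similarity c)// !similarityK.
Qed.

(** Normal form of the resonant set: when the radius is positive, [resonance] vanishes at
    [resonant_point v v1 v2 w] exactly for [w] on this curve. *)
Definition ellipse : set (R * R) :=
  [set w | 2 * (w.1 ^+ 2 + w.1 * w.2 + w.2 ^+ 2) = 1].

Lemma measurable_ellipse : measurable ellipse.
Proof.
rewrite (_ : ellipse =
  (fun w : R * R => 2 * (w.1 ^+ 2 + w.1 * w.2 + w.2 ^+ 2)) @^-1` [set 1])//.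
rewrite -[X in measurable X]setTI.
have : measurable_fun setT (fun w : R * R => 2 * (w.1 ^+ 2 + w.1 * w.2 + w.2 ^+ 2)).
  apply: measurable_funM => //; apply: measurable_funD; last exact: measurable_funX.
  by apply: measurable_funD; [exact: measurable_funX|exact: measurable_funM].
by apply.
Qed.

Lemma hausdorff1_segment_fin : (H1 [set p | `|p.1| <= 1 /\ p.2 = 0]%R < +oo)%E.
Proof.
apply: (@le_lt_trans _ _ 4%:E); last exact: ltey.
apply: ge_ereal_sup => _ [d /= d0 <-].
pose n := Num.trunc (2 / d).
have nd : 2 / d < n.+1%:R by exact: truncnS_gt.
(* Half-open pieces of length [2 / n.+1]; the extra one, of index [n.+1], catches the right
   endpoint. The total [2 * n.+2 / n.+1] is at most 4. *)
pose F k : set (R * R) := if (k < n.+2)%N then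
  [set p | k%:R <= (p.1 + 1) * (n.+1%:R / 2) < k.+1%:R /\ p.2 = 0] else set0.
have dF k : (ediam (F k) <= (2 / n.+1%:R)%:E)%E.
  have n0 : (0 <= (2 / n.+1%:R : R)%:E)%E by rewrite lee_fin divr_ge0.
  rewrite /F; case: ifPn => _; last by rewrite ediam0.
  apply: ediam_le => // p q [/andP[p1 p2] p0] [/andP[q1 q2] q0].
  rewrite lee_fin /edist p0 q0 subrr expr0n/= addr0 sqrtr_sqr.
  have : `|(p.1 - q.1) * (n.+1%:R / 2)| <= 1.
    by rewrite ler_norml; move: p1 p2 q1 q2; rewrite -[k.+1%:R]natr1 => *; apply/andP; split; lra.
  rewrite normrM (@ger0_norm _ (_ / 2)) ?divr_ge0//.
  by rewrite -ler_pdivlMr ?divr_gt0// invf_div mul1r.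
apply: (@le_trans _ _ (\sum_(k <oo) ediam (F k))%E).
  apply: ereal_inf_lbound; exists F => //; split=> [p [/ler_normlP[p1 p1'] p2]|k].
    have h0 : 0 <= (p.1 + 1) * (n.+1%:R / 2).
      by rewrite mulr_ge0// ?divr_ge0//; lra.
    exists (Num.trunc ((p.1 + 1) * (n.+1%:R / 2))) => //; rewrite /F ifT.
      by split => //; exact: truncn_itv.
    rewrite truncn_lt_nat//.
    apply: (@le_lt_trans _ _ (2 * (n.+1%:R / 2))); last first.
      by rewrite mulrCA mulfV// mulr1 ltr_nat.
    by rewrite ler_wpM2r ?divr_ge0//; lra.
  apply: (le_trans (dF k)); rewrite lee_fin ler_pdivrMr// mulrC -ler_pdivrMr//.
  exact: ltW.
rewrite (nneseries_split 0 n.+2); last by move=> *; exact: ediam_ge0.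
rewrite [X in (_ + X)%E]eseries0 ?adde0; last first.
  by move=> i; rewrite add0n /F => ni _; rewrite ltnNge ni/= ediam0.
apply: (@le_trans _ _ (\sum_(0 <= k < 0 + n.+2) (2 / n.+1%:R)%:E)%E).
  by apply: lee_sum => *; exact: dF.
rewrite sumEFin lee_fin sumr_const_nat add0n subn0 -[leLHS]mulr_natr.
rewrite mulrAC ler_pdivrMr// -!natrM ler_nat.
by rewrite -[4%N]/(2 * 2)%N -mulnA leq_pmul2l// mul2n -addnn addSn addnS !ltnS leq_addl.
Qed.

Lemma ellipse_sym (a b : R) : ellipse (a, b) -> ellipse (b, a).
Proof. by rewrite /ellipse/= => h; lra. Qed.

(** The equation of the ellipse gives [(2 * b + a) ^+ 2 = 2 - 3 * a ^+ 2]. *)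
Lemma ellipse_abscissa_le1 (a b : R) : ellipse (a, b) -> `|a| <= 1.
Proof.
rewrite /ellipse/= => ab; rewrite -sqrtr_sqr -[leRHS]sqrtr1 ler_sqrt//.
by have := sqr_ge0 (2 * b + a); nra.
Qed.

(* [2b + a] is half of the partial derivative in [b]: where it stays away from
   [0] with a constant sign [e], the ellipse is a Lipschitz graph over [a]. *)
Lemma ellipse_chord (a b a' b' e : R) : e ^+ 2 = 1 ->
  ellipse (a, b) -> ellipse (a', b') ->
  2^-1 <= e * (2 * b + a) -> 2^-1 <= e * (2 * b' + a') ->
  (b - b') ^+ 2 <= 8 * (a - a') ^+ 2.
Proof.
rewrite /ellipse/= => e1 E E' h h'.
(* Subtracting the two equations of the ellipse gives [(b - b') * S = - ((a - a') * T)], with [S]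
   bounded below and [T] bounded above. *)
pose S := (2 * b + a) + (2 * b' + a'); pose T := (2 * a + b) + (2 * a' + b').
have S1 : 1 <= S ^+ 2.
  have : 1 <= e * S by rewrite /S mulrDr; lra.
  move=> eS; have -> : S ^+ 2 = (e * S) ^+ 2 by rewrite exprMn e1 mul1r.
  exact: exprn_ege1.
have T8 : T ^+ 2 <= 8.
  have t (x y : R) : 2 * (x ^+ 2 + x * y + y ^+ 2) = 1 -> (2 * x + y) ^+ 2 <= 2.
    by move=> xy; have := sqr_ge0 y; nra.
  have := t _ _ E; have := t _ _ E'.
  have := sqr_ge0 ((2 * a + b) - (2 * a' + b')); rewrite /T; nra.
have DE : (b - b') * S = - ((a - a') * T) by rewrite /S /T; nra.
apply: (@le_trans _ _ ((b - b') ^+ 2 * S ^+ 2)).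
  by rewrite -[leLHS]mulr1 ler_wpM2l ?sqr_ge0.
rewrite -exprMn DE sqrrN exprMn mulrC.
by rewrite ler_wpM2r ?sqr_ge0.
Qed.

(** Four arcs cover the ellipse, each a Lipschitz graph over one coordinate with [edist] at most 3
    times the variation of that coordinate (3 is the root of [1 + 8]). They cover because the
    squares of [2 * b + a] and [2 * a + b] add up to [1 + 3 * (a + b) ^+ 2], so both cannot be below
    1/2 in absolute value. *)
Lemma hausdorff1_ellipse_fin : (H1 ellipse < +oo)%E.
Proof.
pose P (s : bool) : set (R * R) :=
  ellipse `&` [set w | 2^-1 <= (-1) ^+ s * (2 * w.2 + w.1)].
pose Q (s : bool) : set (R * R) :=
  ellipse `&` [set w | 2^-1 <= (-1) ^+ s * (2 * w.1 + w.2)].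
have cover : ellipse `<=` (P false `|` P true) `|` (Q false `|` Q true).
  move=> [a b] E.
  have [h1|h1] := leP 2^-1 (2 * b + a).
    by left; left; split => //=; rewrite expr0 mul1r.
  have [h2|h2] := leP 2^-1 (- (2 * b + a)).
    by left; right; split => //=; rewrite expr1 mulN1r.
  have [h3|h3] := leP 2^-1 (2 * a + b).
    by right; left; split => //=; rewrite expr0 mul1r.
  right; right; split => //=; rewrite expr1 mulN1r leNgt; apply/negP => h4.
  move: E; rewrite /ellipse/= => E.
  have h : (2 * b + a) ^+ 2 + (2 * a + b) ^+ 2 = 1 + 3 * (a + b) ^+ 2 by nra.
  have := sqr_ge0 (a + b).
  have : (2 * b + a) ^+ 2 <= 4^-1 by nra.
  have : (2 * a + b) ^+ 2 <= 4^-1 by nra.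
  by lra.
have sgn2 (s : bool) : ((-1) ^+ s : R) ^+ 2 = 1 by rewrite sqrr_sign.
have fin (phi : R * R -> R) A : (forall p, A p -> `|phi p| <= 1) ->
    (forall p q, A p -> A q -> edist p q <= 3 * `|phi p - phi q|) ->
    (H1 A < +oo)%E.
  move=> phi1 dphi.
  have h : (H1 A <= 3%:E * H1 ((fun p => (phi p, 0%R)) @` A))%E.
    apply: hausdorff1_le_image => // p q Ap Aq.
    by rewrite {2}/edist/= subrr expr0n/= addr0 sqrtr_sqr dphi.
  apply: le_lt_trans h _; apply: lte_mul_pinfty; rewrite ?lee_fin//.
  apply: le_lt_trans hausdorff1_segment_fin.
  by apply: le_hausdorff1 => _ [p Ap <-]; split => //=; exact: phi1.
have bound (x y : R) : y ^+ 2 <= 8 * x ^+ 2 -> Num.sqrt (x ^+ 2 + y ^+ 2) <= 3 * `|x|.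
  move=> yx; rewrite -[3]gtr0_norm// -normrM -sqrtr_sqr ler_sqrt ?sqr_ge0//.
  by rewrite exprMn; lra.
have fP s : (H1 (P s) < +oo)%E.
  apply: (fin fst) => [[a b] [/ellipse_abscissa_le1//]|[a b] [a' b'] [E h] [E' h']].
  exact/bound/(ellipse_chord (sgn2 s)).
have fQ s : (H1 (Q s) < +oo)%E.
  apply: (fin snd) => [[a b] [/ellipse_sym/ellipse_abscissa_le1//]|].
  move=> [a b] [a' b'] [/ellipse_sym E h] [/ellipse_sym E' h'].
  by rewrite /edist addrC; exact/bound/(ellipse_chord (sgn2 s)).
apply: le_lt_trans (le_hausdorff1 cover) _.
apply: le_lt_trans (outer_measureU2 _ _ _) _.
have f2 (A B : set (R * R)) : (H1 A < +oo -> H1 B < +oo -> H1 (A `|` B) < +oo)%E.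
  move=> fA fB; apply: le_lt_trans (outer_measureU2 _ _ _) _.
  exact: lte_add_pinfty.
by apply: lte_add_pinfty; apply: f2.
Qed.
End curves.

(** * The delta integral as an integral over the ellipse *)

Section resonant_curve.
Context {R : realType}.
Implicit Types (A X : set (R * R)) (p q w : R * R) (v r c : R).

(** Restricted to the ellipse the Hausdorff measure is finite, which lets Fubini's theorem apply. *)
Definition ellipse_measure : set (R * R) -> \bar R :=
  mrestr (@curve_borel R) measurable_ellipse.

HB.instance Definition _ := Measure.on ellipse_measure.

Let ellipse_measure_fin : fin_num_fun ellipse_measure.
Proof.
move=> A mA; rewrite ge0_fin_numE; last exact: hausdorff1_ge0.
by apply: le_lt_trans hausdorff1_ellipse_fin; apply: le_hausdorff1 => w [].
Qed.

HB.instance Definition _ := Measure_isFinite.Build _ _ _ ellipse_measure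
  ellipse_measure_fin.

Lemma integral_ellipse_measure (f : R * R -> \bar R) :
  (\int[@curve_borel R]_(w in ellipse) f w =
   \int[ellipse_measure]_(w in ellipse) f w)%E.
Proof.
apply: eq_measure_integral => A mA AE.
by rewrite /= /ellipse_measure /mrestr (setIidl AE).
Qed.

(** The mean velocity, common to the incoming and outgoing triples by conservation of momentum. *)
Definition sphere_center v v1 v2 : R := (v + v1 + v2) / 3.

(** Its square is the sum of the squared deviations from the mean, common to both triples by
    conservation of momentum and energy. *)
Definition sphere_radius v v1 v2 : R :=
  Num.sqrt (v ^+ 2 + v1 ^+ 2 + v2 ^+ 2 - (v + v1 + v2) ^+ 2 / 3).

Lemma sphere_radius_sqr v v1 v2 : sphere_radius v v1 v2 ^+ 2 =
  v ^+ 2 + v1 ^+ 2 + v2 ^+ 2 - (v + v1 + v2) ^+ 2 / 3.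
Proof.
rewrite sqr_sqrtr//.
have := sqr_ge0 (v - v1); have := sqr_ge0 (v1 - v2); have := sqr_ge0 (v - v2).
by lra.
Qed.

Lemma resonanceE v v1 v2 p : resonance v v1 v2 p =
  v ^+ 2 + v1 ^+ 2 + v2 ^+ 2 - p.1 ^+ 2 - p.2 ^+ 2 - (v + v1 + v2 - p.1 - p.2) ^+ 2.
Proof. by rewrite /resonance !real_normK ?num_real. Qed.

Definition resonant_point v v1 v2 w : R * R :=
  similarity (sphere_center v v1 v2) (sphere_radius v v1 v2) w.

Lemma resonance_point v v1 v2 w :
  resonance v v1 v2 (resonant_point v v1 v2 w) =
  sphere_radius v v1 v2 ^+ 2 * (1 - 2 * (w.1 ^+ 2 + w.1 * w.2 + w.2 ^+ 2)).
Proof.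
rewrite resonanceE /resonant_point /similarity/=.
set r := sphere_radius _ _ _; set c := sphere_center _ _ _.
have hr : r ^+ 2 = v ^+ 2 + v1 ^+ 2 + v2 ^+ 2 - (v + v1 + v2) ^+ 2 / 3.
  exact: sphere_radius_sqr.
rewrite mulrBr mulr1 {1}hr /c /sphere_center; by field.
Qed.

Definition ellipse_grad w : R :=
  Num.sqrt ((4 * w.1 + 2 * w.2) ^+ 2 + (2 * w.1 + 4 * w.2) ^+ 2).

Lemma grad_norm_resonance v v1 v2 p :
  grad_norm (resonance v v1 v2) p =
  ellipse_grad (p.1 - sphere_center v v1 v2, p.2 - sphere_center v v1 v2).
Proof.
rewrite /grad_norm /ellipse_grad.
have D (a b s : R) :
    derive1 (fun y : R => s - y ^+ 2 - b ^+ 2 - (v + v1 + v2 - y - b) ^+ 2) a =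
    2 * (v + v1 + v2 - a - b) - 2 * a.
  rewrite derive1E.
  pose f : R -> R := cst s - (@id R) ^+ 2 - cst (b ^+ 2) -
    (cst (v + v1 + v2 - b) - (@id R)) ^+ 2.
  rewrite (_ : (fun y : R => _) = f); last first.
    by apply/funext => y; rewrite /f !fctE; congr (_ - _ - _ - _ ^+ 2); ring.
  rewrite /f derive_val; rewrite !fctE/= /GRing.scale/=; ring.
have D1 : derive1 (fun y => resonance v v1 v2 (y, p.2)) p.1 =
    2 * (v + v1 + v2 - p.1 - p.2) - 2 * p.1.
  rewrite (_ : (fun y => _) = fun y => v ^+ 2 + v1 ^+ 2 + v2 ^+ 2 - y ^+ 2 -
    p.2 ^+ 2 - (v + v1 + v2 - y - p.2) ^+ 2); first exact: D.
  by apply/funext => y; rewrite resonanceE.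
have D2 : derive1 (fun y => resonance v v1 v2 (p.1, y)) p.2 =
    2 * (v + v1 + v2 - p.2 - p.1) - 2 * p.2.
  rewrite (_ : (fun y => _) = fun y => v ^+ 2 + v1 ^+ 2 + v2 ^+ 2 - y ^+ 2 -
    p.1 ^+ 2 - (v + v1 + v2 - y - p.1) ^+ 2); first exact: D.
  by apply/funext => y; rewrite resonanceE/=; ring.
rewrite D1 D2; congr Num.sqrt; rewrite /sphere_center/=; by field.
Qed.

Lemma ellipse_grad_similarity r w : 0 <= r ->
  ellipse_grad (r * w.1, r * w.2) = r * ellipse_grad w.
Proof.
move=> r0; rewrite /ellipse_grad/= -[X in _ = X * _](ger0_norm r0) -sqrtr_sqr -sqrtrM ?sqr_ge0//.
by congr Num.sqrt; ring.
Qed.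

(** On the ellipse the square of the gradient norm is [4 + 12 * (w.1 + w.2) ^+ 2]. The bound keeps
    the density of the delta integral at most 1. *)
Lemma ellipse_grad_ge1 w : ellipse w -> 1 <= ellipse_grad w.
Proof.
rewrite /ellipse/= => E; rewrite -sqrtr1 ler_sqrt ?addr_ge0 ?sqr_ge0//.
by have := sqr_ge0 (w.1 + w.2); nra.
Qed.

Lemma measurable_ellipse_grad : measurable_fun setT ellipse_grad.
Proof.
apply: (measurableT_comp (continuous_measurable_fun (@sqrt_continuous R))).
by apply: measurable_funD; apply: measurable_funX; apply: measurable_funD;
  apply: measurable_funM.
Qed.

(** The inverse is discontinuous at 0, so it is written as [x] times a real power of [x ^+ 2]; both
    sides vanish at 0. *)
Lemma measurable_inv : measurable_fun setT (@GRing.inv R).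
Proof.
rewrite (_ : GRing.inv = fun x : R => x * (x ^+ 2) `^ (-1)); last first.
  apply/funext => x; rewrite powR_inv1 ?sqr_ge0//.
  have [->|x0] := eqVneq x 0; first by rewrite invr0 mul0r.
  by rewrite expr2 invfM mulrA mulfV// mul1r.
apply: measurable_funM => //.
by apply: (measurableT_comp (measurable_powR _)); exact: measurable_funX.
Qed.

Lemma measurable_resonance v v1 v2 : measurable_fun setT (resonance v v1 v2).
Proof.
rewrite (funext (resonanceE v v1 v2)).
by do !apply: measurable_funB => //; apply: measurable_funX => //;
  do !apply: measurable_funB.
Qed.

Lemma measurable_resonant_point v v1 v2 :
  measurable_fun setT (resonant_point v v1 v2).
Proof. exact: measurable_similarity. Qed.

(** By [curve_borel_similarity] the measure is [r] times its own pushforward under the similarity,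
    and the preimage of the resonant set is the ellipse. *)
Lemma ge0_integral_resonance v v1 v2 (f : R * R -> \bar R) :
  0 < sphere_radius v v1 v2 -> measurable_fun setT f -> (forall p, 0 <= f p)%E ->
  (\int[curve_measure]_(p in [set p | resonance v v1 v2 p = 0%R]) f p =
   \int[ellipse_measure]_(w in ellipse)
     ((sphere_radius v v1 v2)%:E * f (resonant_point v v1 v2 w)))%E.
Proof.
move=> r0 mf f0; set r := sphere_radius v v1 v2.
set D := [set p | _].
have mD : measurable D.
  have := measurable_resonance v v1 v2 measurableT (measurable_set1 0).
  by rewrite setTI.
have mphi := measurable_resonant_point v v1 v2.
have mfphi : measurable_fun setT (f \o resonant_point v v1 v2).
  exact: measurableT_comp.
rewrite ge0_integral_curve_borel//; last exact: measurable_funTS.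
have [m mE] : exists m : {measure set (R * R) -> \bar R},
    m = pushforward (@curve_borel R) (resonant_point v v1 v2) :> (set _ -> _).
  unshelve refine (ex_intro _ (pushforward (@curve_borel R)
    (resonant_point v v1 v2) : {measure set (R * R) -> \bar R}) _) => //.
transitivity (\int[mscale (NngNum (ltW r0)) m]_(p in D) f p)%E.
  apply: eq_measure_integral => A mA AD.
  by rewrite [LHS](curve_borel_similarity (sphere_center v v1 v2) _ r0) -mE.
rewrite ge0_integral_mscale//; last exact: measurable_funTS.
rewrite mE (ge0_integral_pushforward mphi)//; last exact: measurable_funTS.
rewrite ge0_integralZl_EFin//; last 3 first.
- exact: measurable_ellipse.
- exact: measurable_funTS.
- exact: ltW.
rewrite -integral_ellipse_measure; congr (_ * integral _ _ _)%E.
apply/seteqP; split => w; rewrite /D/= resonance_point => /eqP.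
  by rewrite mulf_eq0 sqrf_eq0 gt_eqF//= subr_eq0 => /eqP.
by move=> /eqP ->; rewrite subrr mulr0.
Qed.

Lemma measurable_grad_norm_resonance v v1 v2 :
  measurable_fun setT (grad_norm (resonance v v1 v2)).
Proof.
rewrite (funext (grad_norm_resonance v v1 v2)).
apply: (measurableT_comp measurable_ellipse_grad).
by apply: measurable_fun_pair; apply: measurable_funB.
Qed.

(* When [v = v1 = v2] the resonant set is a point where the gradient vanishes:
   both sides are [0], by [x / 0 = 0]. *)
Lemma delta_integral_resonance v v1 v2 (F : R * R -> R) : measurable_fun setT F ->
  let r := sphere_radius v v1 v2 in
  delta_integral (resonance v v1 v2) F =
  \int[ellipse_measure]_(w in ellipse)
    (r * (F (resonant_point v v1 v2 w) / (r * ellipse_grad w))).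
Proof.
move=> mF r; rewrite /delta_integral.
have [r0|r0] := eqVneq r 0.
  transitivity (\int[@curve_measure R]_(p in [set p | resonance v v1 v2 p = 0]) 0).
    apply: eq_Rintegral => p; rewrite inE/= resonanceE => hp.
    rewrite grad_norm_resonance.
    have := sphere_radius_sqr v v1 v2; rewrite -/r r0 expr0n/= => hr.
    pose a := p.1 - sphere_center v v1 v2; pose b := p.2 - sphere_center v v1 v2.
    (* The left side is the squared radius minus the resonance function, both zero here. *)
    have hab : (a + b) ^+ 2 + (a ^+ 2 + b ^+ 2) = 0.
      rewrite /a /b /sphere_center.
      transitivity (v ^+ 2 + v1 ^+ 2 + v2 ^+ 2 - (v + v1 + v2) ^+ 2 / 3 -
        (v ^+ 2 + v1 ^+ 2 + v2 ^+ 2 - p.1 ^+ 2 - p.2 ^+ 2 - (v + v1 + v2 - p.1 - p.2) ^+ 2)).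
        by field.
      by rewrite hp -hr subrr.
    have [a2 b2] : a ^+ 2 = 0 /\ b ^+ 2 = 0.
      by have := sqr_ge0 a; have := sqr_ge0 b; have := sqr_ge0 (a + b); lra.
    move: a2 b2 => /eqP; rewrite sqrf_eq0 => /eqP a0 /eqP; rewrite sqrf_eq0 => /eqP b0.
    rewrite -/a -/b a0 b0 /ellipse_grad/= !mulr0 addr0 expr0n/= addr0 sqrtr0.
    by rewrite invr0 mulr0.
  rewrite /Rintegral integral0.
  by under eq_integral do rewrite r0 mul0r; rewrite integral0.
have {}r0 : 0 < r by rewrite lt_neqAle eq_sym r0 sqrtr_ge0.
have mG : measurable_fun setT (fun p => (F p / grad_norm (resonance v v1 v2) p)%:E).
  apply/measurable_EFinP; apply: measurable_funM => //.
  apply: (measurableT_comp measurable_inv).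
  exact: measurable_grad_norm_resonance.
congr fine; rewrite integralE [RHS]integralE.
rewrite !ge0_integral_resonance//; last 2 first.
- exact: measurable_funeneg.
- exact: measurable_funepos.
have gE w : (r * (F (resonant_point v v1 v2 w) / (r * ellipse_grad w)))%:E =
  (r%:E * ((fun p => (F p / grad_norm (resonance v v1 v2) p)%:E) \o
    resonant_point v v1 v2) w)%E.
  rewrite -EFinM/= grad_norm_resonance; congr (r * (_ / _))%:E.
  rewrite -ellipse_grad_similarity ?(ltW r0)//.
  by rewrite /resonant_point /similarity/= !(addrC (sphere_center _ _ _)) !addrK.
rewrite (funext gE) ge0_funeposM ?(ltW r0)// ge0_funenegM ?(ltW r0)//.
by congr (_ - _)%E; apply: eq_integral => w _;
  rewrite ?funeposE ?funenegE.
Qed.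

End resonant_curve.

(** * Weighted comparison of products *)

Section comparison.
Context {R : realDomainType}.
Implicit Types (F D w a b c : R).

(* [F] and [D] are the weighted norms of the two functions and of their
   difference, [w] is the weight. *)
Definition comparable_at F D w a b : Prop :=
  [/\ `|a| <= F * w, `|b| <= F * w & `|a - b| <= D * w].

Lemma comparable_at_weight F D w w' a b : 0 <= F -> 0 <= D -> w <= w' ->
  comparable_at F D w a b -> comparable_at F D w' a b.
Proof.
move=> F0 D0 ww' [ha hb hab].
by split; [apply: le_trans ha _|apply: le_trans hb _|apply: le_trans hab _];
  rewrite ler_wpM2l.
Qed.

(** The difference constants follow the Leibniz rule. *)
Lemma comparable_atM F1 D1 w1 a1 b1 F2 D2 w2 a2 b2 :
  comparable_at F1 D1 w1 a1 b1 -> comparable_at F2 D2 w2 a2 b2 ->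
  comparable_at (F1 * F2) (F1 * D2 + D1 * F2) (w1 * w2) (a1 * a2) (b1 * b2).
Proof.
move=> [ha1 hb1 h1] [ha2 hb2 h2]; split.
- by rewrite normrM mulrACA ler_pM.
- by rewrite normrM mulrACA ler_pM.
- rewrite (_ : _ - _ = a1 * (a2 - b2) + (a1 - b1) * b2); last by ring.
  rewrite [leRHS]mulrDl !(mulrACA _ _ w1) (le_trans (ler_normD _ _))// lerD// normrM.
    exact: ler_pM.
  exact: ler_pM.
Qed.

Lemma comparable_atD F1 D1 F2 D2 w a1 b1 a2 b2 :
  comparable_at F1 D1 w a1 b1 -> comparable_at F2 D2 w a2 b2 ->
  comparable_at (F1 + F2) (D1 + D2) w (a1 + a2) (b1 + b2).
Proof.
move=> [ha1 hb1 h1] [ha2 hb2 h2]; rewrite /comparable_at !mulrDl; split.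
- by rewrite (le_trans (ler_normD _ _))// lerD.
- by rewrite (le_trans (ler_normD _ _))// lerD.
- by rewrite opprD addrACA (le_trans (ler_normD _ _))// lerD.
Qed.

Lemma comparable_atN F D w a b :
  comparable_at F D w a b -> comparable_at F D w (- a) (- b).
Proof. by move=> [ha hb hab]; split; rewrite -?opprD normrN. Qed.

Lemma comparable_at_scale F D w a b c : `|c| <= 1 ->
  comparable_at F D w a b -> comparable_at F D w (c * a) (c * b).
Proof.
have h x y : `|c| <= 1 -> `|x| <= y -> `|c * x| <= y.
  by move=> c1 xy; rewrite normrM (le_trans _ xy)// ler_piMl.
by move=> c1 [ha hb hab]; split; rewrite -?mulrBr; exact: h.
Qed.

End comparison.

(* [6] monomials of degree [5], each [5 * F ^+ 4]-Lipschitz for the weights. *)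
Lemma comparable_at_interaction {R : realType} (F D w w1 w2 w3 w4 w5
    a a1 a2 a3 a4 a5 b b1 b2 b3 b4 b5 : R) :
  0 <= F -> 0 <= D -> 0 <= w <= 1 -> 0 <= w1 <= 1 -> 0 <= w2 <= 1 ->
  0 <= w3 <= 1 -> 0 <= w4 <= 1 -> 0 <= w5 <= 1 ->
  w3 * w4 * w5 = w * w1 * w2 ->
  comparable_at F D w a b -> comparable_at F D w1 a1 b1 ->
  comparable_at F D w2 a2 b2 -> comparable_at F D w3 a3 b3 ->
  comparable_at F D w4 a4 b4 -> comparable_at F D w5 a5 b5 ->
  comparable_at (6 * F ^+ 5) (30 * F ^+ 4 * D) (w * w1 * w2)
    (interaction a a1 a2 a3 a4 a5) (interaction b b1 b2 b3 b4 b5).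
Proof.
move=> F0 D0 w01 w101 w201 w301 w401 w501 wE h h1 h2 h3 h4 h5.
(* In each quintic monomial three factors keep their weights; the weights of the other two are
   bounded by 1. *)
have pair u u' x x' y y' : 0 <= u <= 1 -> 0 <= u' <= 1 ->
    comparable_at F D u x y -> comparable_at F D u' x' y' ->
    comparable_at (F * F) (F * D + D * F) 1 (x * x') (y * y').
  move=> /andP[u0 u1] /andP[u'0 u'1] hx hx'.
  apply: comparable_at_weight (comparable_atM hx hx'); rewrite ?mulr_ge0//.
    by rewrite addr_ge0// mulr_ge0.
  by rewrite mulr_ile1.
have side u1 u2 u3 v1 v2 v3 x1 x2 x3 x4 x5 x6 y1 y2 y3 y4 y5 y6 :
    0 <= v1 <= 1 -> 0 <= v2 <= 1 -> 0 <= v3 <= 1 ->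
    comparable_at F D u1 x1 y1 -> comparable_at F D u2 x2 y2 ->
    comparable_at F D u3 x3 y3 -> comparable_at F D v1 x4 y4 ->
    comparable_at F D v2 x5 y5 -> comparable_at F D v3 x6 y6 ->
    comparable_at (3 * F ^+ 5) (15 * F ^+ 4 * D) (u1 * u2 * u3)
      (x1 * x2 * x3 * (x4 * x5 + x4 * x6 + x5 * x6))
      (y1 * y2 * y3 * (y4 * y5 + y4 * y6 + y5 * y6)).
  move=> v01 v02 v03 H1 H2 H3 H4 H5 H6.
  have := comparable_atM (comparable_atM (comparable_atM H1 H2) H3)
    (comparable_atD (comparable_atD (pair _ _ _ _ _ _ v01 v02 H4 H5)
      (pair _ _ _ _ _ _ v01 v03 H4 H6)) (pair _ _ _ _ _ _ v02 v03 H5 H6)).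
  by rewrite mulr1; congr comparable_at; ring.
rewrite /interaction.
have gain := side _ _ _ _ _ _ _ _ _ _ _ _ _ _ _ _ _ _ w01 w101 w201 h3 h4 h5 h h1 h2.
have loss := side _ _ _ _ _ _ _ _ _ _ _ _ _ _ _ _ _ _ w301 w401 w501 h h1 h2 h3 h4 h5.
(* The gain term carries [w3 * w4 * w5], which the resonance turns into the weight of the loss
   term. *)
rewrite wE in gain.
by have := comparable_atD gain (comparable_atN loss); congr comparable_at; ring.
Qed.

(** * Parametric, Gaussian and Lorentzian integrals *)

Section integrals.
Context {R : realType}.
Local Notation leb := (@lebesgue_measure R).

(* The canonical instances of the library on [m1 \x m2] only recognize it as
   sigma-finite when [m1] and [m2] are subprobabilities. *)
Definition plane_measure : set (measurableTypeR R * measurableTypeR R) -> \bar R :=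
  (leb \x leb)%E.
HB.instance Definition _ := Measure.on plane_measure.

Let plane_measure_sigma_finite : sigma_finite setT plane_measure.
Proof.
pose F n : set R := [set` `[- n%:R, n%:R]].
exists (fun n => F n `*` F n).
  apply/esym; rewrite -subTset => -[x y] _.
  exists (Num.bound (`|x| + `|y|)) => //.
  have h : `|x| + `|y| <= (Num.bound (`|x| + `|y|))%:R.
    by apply/ltW/archi_boundP; rewrite addr_ge0.
  split; rewrite /F/= in_itv/= -ler_norml; apply: le_trans h.
    by rewrite lerDl.
  by rewrite lerDr.
move=> n; have mF : measurable (F n) by exact: measurable_itv.
split; first exact: measurableX.
have -> : plane_measure (F n `*` F n) = (leb (F n) * leb (F n))%E.
  exact: product_measure1E.
by rewrite lebesgue_measure_itv/=; case: ifPn => _; rewrite ?mule0 -?EFinB -?EFinM ltey.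
Qed.

HB.instance Definition _ := @Measure_isSigmaFinite.Build _ _ _ plane_measure
  plane_measure_sigma_finite.

(** Domination by multiples of the integrable weight makes both integrals converge, so no default
    value of the integral intervenes. *)
Lemma comparable_at_Rintegral d (T : measurableType d)
    (mu : {measure set T -> \bar R}) (E : set T) (F D : R) (w f g : T -> R) :
  measurable E -> measurable_fun E f -> measurable_fun E g ->
  mu.-integrable E (EFin \o w) ->
  (forall x, E x -> comparable_at F D (w x) (f x) (g x)) ->
  comparable_at F D (\int[mu]_(x in E) w x)
    (\int[mu]_(x in E) f x) (\int[mu]_(x in E) g x).
Proof.
move=> mE mf mg iw fg.
have iZ c : mu.-integrable E (EFin \o (fun x => c * w x)).
  by rewrite (_ : _ \o _ = fun x => c%:E * (EFin \o w) x)%E//; exact: integrableZl.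
have key c (h : T -> R) : measurable_fun E h ->
    (forall x, E x -> `|h x| <= c * w x) ->
    mu.-integrable E (EFin \o h) /\ `|\int[mu]_(x in E) h x| <= c * \int[mu]_(x in E) w x.
  move=> mh hc.
  have ih : mu.-integrable E (EFin \o h).
    apply: (le_integrable mE _ _ (iZ c)); first exact/measurable_EFinP.
    by move=> x Ex /=; rewrite lee_fin (le_trans (hc x Ex))// ler_norm.
  split => //; apply: le_trans (le_normr_Rintegral mE ih) _.
  rewrite -RintegralZl//; apply: le_Rintegral => //.
  exact: (@integrable_norm _ _ _ _ _ h).
have [if_ Hf] := key F f mf (fun x Ex => let: And3 h _ _ := fg x Ex in h).
have [ig Hg] := key F g mg (fun x Ex => let: And3 _ h _ := fg x Ex in h).
split => //; rewrite -RintegralB//.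
by apply: (key D (fun x => f x - g x) (measurable_funB mf mg) _).2 => x /fg[].
Qed.

(** Tonelli's theorem handles the positive and negative parts; the extended difference and [fine]
    are measurable. *)
Lemma measurable_Rintegral_param d1 d2 (T1 : measurableType d1)
    (T2 : measurableType d2) (mu : {sigma_finite_measure set T2 -> \bar R})
    (f : T1 * T2 -> R) : measurable_fun setT f ->
  measurable_fun setT (fun x => \int[mu]_y f (x, y)).
Proof.
move=> mf; apply: (measurableT_comp (fine_measurable measurableT)).
rewrite (_ : (fun x => _) = (fun x => fubini_F mu (EFin \o f)^\+ x
    - fubini_F mu (EFin \o f)^\- x)%E); last first.
  apply/funext => x; rewrite integralE /fubini_F.
  by congr (_ - _)%E; apply: eq_integral => y _; rewrite ?funeposE ?funenegE.
have mF : measurable_fun setT (EFin \o f) by exact/measurable_EFinP.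
apply: emeasurable_funB; apply: measurable_fun_fubini_tonelli_F => //.
- exact: measurable_funepos.
- exact: measurable_funeneg.
Qed.

(** Extension by zero outside the domain reduces this to the integral over the whole space; it
    serves time intervals whose ends depend on the parameter. *)
Lemma measurable_Rintegral_param_in d1 d2 (T1 : measurableType d1)
    (T2 : measurableType d2) (mu : {sigma_finite_measure set T2 -> \bar R})
    (E : T1 -> set T2) (f : T1 * T2 -> R) :
  measurable [set z : T1 * T2 | E z.1 z.2] -> measurable_fun setT f ->
  measurable_fun setT (fun x => \int[mu]_(y in E x) f (x, y)).
Proof.
move=> mE mf.
under eq_fun do rewrite Rintegral_mkcond.
apply: (@measurable_Rintegral_param _ _ _ _ mu
  (fun z => ((fun y => f (z.1, y)) \_ (E z.1)) z.2)).
rewrite (_ : (fun z => _) = f \_ [set z : T1 * T2 | E z.1 z.2]).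
  by apply/(measurable_restrictT f mE); exact: measurable_funTS.
apply/funext => -[x y]; rewrite /patch/=.
by congr (if _ then _ else _); apply/idP/idP; rewrite !inE.
Qed.

Lemma gaussian_integral (k c : R) : 0 < k ->
  (\int[@lebesgue_measure R]_u (expR (- (k * (u - c) ^+ 2)))%:E =
   (Num.sqrt (pi / k))%:E)%E.
Proof.
(* The standard deviation for which the normal density is proportional to the integrand. *)
move=> k0; pose s : R := Num.sqrt (2 * k)^-1.
have s0 : s != 0 by rewrite gt_eqF// sqrtr_gt0 invr_gt0 mulr_gt0.
have s2 : s ^+ 2 = (2 * k)^-1 by rewrite sqr_sqrtr// invr_ge0 mulr_ge0// ltW.
have pk : normal_peak s = (Num.sqrt (pi / k))^-1.
  rewrite /normal_peak s2; congr (Num.sqrt _)^-1.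
  by field; rewrite gt_eqF.
transitivity (\int[@lebesgue_measure R]_u
    ((Num.sqrt (pi / k))%:E * (normal_pdf c s u)%:E))%E.
  apply: eq_integral => u _; rewrite -EFinM.
  have -> : normal_pdf c s u = normal_peak s * normal_fun c s u.
    by rewrite /normal_pdf (negbTE s0).
  rewrite pk.
  rewrite mulVKf; last by rewrite gt_eqF// sqrtr_gt0 divr_gt0// pi_gt0.
  rewrite /normal_fun s2; congr (expR _)%:E.
  by field; rewrite gt_eqF.
rewrite ge0_integralZl_EFin// ?sqrtr_ge0//.
- by rewrite integral_normal_pdf mule1.
- by move=> u _; rewrite lee_fin normal_pdf_ge0.
- by apply/measurable_EFinP; exact: measurable_normal_pdf.
Qed.

Lemma gaussian_integral2 (k c : R) : 0 < k ->
  (\int[@lebesgue_measure R \x @lebesgue_measure R]_u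
    (expR (- (k * (u.1 - c) ^+ 2)) * expR (- (k * (u.2 - c) ^+ 2)))%:E =
   (pi / k)%:E)%E.
Proof.
move=> k0.
have mG : measurable_fun setT (fun u : R => expR (- (k * (u - c) ^+ 2))).
  apply: (measurableT_comp (@measurable_expR R)); apply: measurableT_comp => //.
  by apply: measurable_funM => //; apply: measurable_funX; exact: measurable_funB.
rewrite fubini_tonelli1//=; last first.
  apply/measurable_EFinP; apply: measurable_funM.
    exact: (measurableT_comp mG measurable_fst).
  exact: (measurableT_comp mG measurable_snd).
rewrite /fubini_F/=.
have mGE : measurable_fun setT (fun u : R => (expR (- (k * (u - c) ^+ 2)))%:E).
  exact/measurable_EFinP.
transitivity (\int[@lebesgue_measure R]_x
    ((Num.sqrt (pi / k))%:E * (expR (- (k * (x - c) ^+ 2)))%:E))%E.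
  apply: eq_integral => x _.
  by rewrite muleC -(gaussian_integral c k0) -ge0_integralZl_EFin ?expR_ge0//.
rewrite ge0_integralZl_EFin ?sqrtr_ge0// gaussian_integral// -EFinM -expr2.
by rewrite sqr_sqrtr// divr_ge0 ?pi_ge0// ltW.
Qed.

(** The antiderivative is [l^-1 * atan (k * s)], and the arctangent ranges over an interval of
    length [pi]. *)
Lemma lorentzian_integral (a b alpha beta : R) : 0 < alpha -> 0 < beta ->
  a <= b ->
  (@lebesgue_measure R).-integrable `[a, b]
    (EFin \o (fun s => (beta + alpha * s ^+ 2)^-1)) /\
  \int[@lebesgue_measure R]_(s in `[a, b]) (beta + alpha * s ^+ 2)^-1 <=
    pi / Num.sqrt (alpha * beta).
Proof.
move=> a0 b0 ab.
pose f s := (beta + alpha * s ^+ 2)^-1.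
pose k := Num.sqrt (alpha / beta); pose l := Num.sqrt (alpha * beta).
have k2 : k ^+ 2 = alpha / beta by rewrite sqr_sqrtr// divr_ge0// ltW.
have kl : k / l = beta^-1.
  rewrite /k /l -sqrtrV ?mulr_ge0 ?ltW// -sqrtrM ?divr_ge0 ?ltW//.
  rewrite (_ : alpha / beta / (alpha * beta) = beta^-1 ^+ 2); last first.
    by field; rewrite !gt_eqF.
  by rewrite sqrtr_sqr ger0_norm// invr_ge0 ltW.
have l0 : 0 < l by rewrite sqrtr_gt0 mulr_gt0.
have den s : beta + alpha * s ^+ 2 != 0.
  by rewrite gt_eqF// ltr_wpDr// mulr_ge0 ?sqr_ge0// ltW.
have cf : continuous f.
  move=> s; apply: cvgV => //.
  apply: cvgD; first exact: cvg_cst.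
  by apply: cvgM; [exact: cvg_cst|apply: exprn_continuous].
have itf : (@lebesgue_measure R).-integrable `[a, b] (EFin \o f).
  apply: continuous_compact_integrable; first exact: segment_compact.
  exact: continuous_subspaceT.
split => //.
move: ab; rewrite le_eqVlt => /predU1P[<-|ab].
  by rewrite set_itv1 Rintegral_set1 divr_ge0 ?pi_ge0 ?sqrtr_ge0.
pose G s := l^-1 * atan (k * s).
have dG (s : R) : is_derive s 1 G (f s).
  rewrite /G (_ : (fun s => _) = l^-1 *: (@atan R \o (k *: id))) //.
  apply: is_derive_eq.
  rewrite -[LHS]/(l^-1 * ((1 + (k * s) ^+ 2)^-1 * (k * 1))) mulr1 mulrCA mulrC.
  rewrite [_ * k]mulrC kl exprMn k2 -invfM; congr _^-1.
  by field; rewrite gt_eqF.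
have cG : continuous G.
  by move=> s; apply: differentiable_continuous; apply/derivable1_diffP; apply: ex_derive.
rewrite /Rintegral (@continuous_FTC2 _ f G)//.
- rewrite /G -EFinB/= -mulrBr mulrC ler_pM2r ?invr_gt0//.
  have := atan_ltpi2 (k * b); have := atan_gtNpi2 (k * a); lra.
- exact: continuous_subspaceT.
- split.
  + by move=> s _; exact: ex_derive.
  + by apply: cvg_at_right_filter; exact: cG.
  + by apply: cvg_at_left_filter; exact: cG.
- by move=> s _; rewrite derive1E derive_val.
Qed.

End integrals.

(** * The collision operator *)

Ltac measurable_projection := do ?[exact: measurable_fst | exact: measurable_snd |
  exact: measurable_id | apply: (measurableT_comp measurable_fst) |
  apply: (measurableT_comp measurable_snd)].

Section collision.
Context {R : realType}.
Local Notation leb := (@lebesgue_measure R).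
Implicit Types f g : R -> R -> R -> R.

Lemma measurable3_comp d (T : measurableType d) f (a b c : T -> R) :
  measurable3 f -> measurable_fun setT a -> measurable_fun setT b ->
  measurable_fun setT c -> measurable_fun setT (fun z => f (a z) (b z) (c z)).
Proof.
move=> mf ma mb mc.
apply: (measurableT_comp mf (_ : measurable_fun setT (fun z => (a z, b z, c z)))).
by do 2 apply: measurable_fun_pair => //.
Qed.

Lemma measurable_sphere_radius d (T : measurableType d) (a b c : T -> R) :
  measurable_fun setT a -> measurable_fun setT b -> measurable_fun setT c ->
  measurable_fun setT (fun z => sphere_radius (a z) (b z) (c z)).
Proof.
move=> ma mb mc.
apply: (measurableT_comp (continuous_measurable_fun (@sqrt_continuous R))).
apply: measurable_funB.
  by do !apply: measurable_funD => //; exact: measurable_funX.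
apply: measurable_funM => //; apply: measurable_funX.
by do !apply: measurable_funD => //.
Qed.

Definition collision_integrand f (t x v : R) (w p : R * R) : R :=
  interaction (f t x v) (f t x w.1) (f t x w.2) (f t x p.1) (f t x p.2)
    (f t x (v + w.1 + w.2 - p.1 - p.2)).

(** The factors [r], from the arc length and from the gradient, are left uncancelled: the kernel is
    then 0 when [r = 0], in agreement with the degenerate delta integral. *)
Definition collision_kernel f (t x v : R) (w u : R * R) : R :=
  let r := sphere_radius v w.1 w.2 in
  r * (collision_integrand f t x v w (resonant_point v w.1 w.2 u)
       / (r * ellipse_grad u)).

Lemma measurable_collision_integrand d (T : measurableType d) f
    (t x v : T -> R) (w p : T -> R * R) : measurable3 f ->
  measurable_fun setT t -> measurable_fun setT x -> measurable_fun setT v ->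
  measurable_fun setT w -> measurable_fun setT p ->
  measurable_fun setT (fun z => collision_integrand f (t z) (x z) (v z) (w z) (p z)).
Proof.
move=> mf mt mx mv mw mp.
have mw1 : measurable_fun setT (fun z => (w z).1) := measurableT_comp measurable_fst mw.
have mw2 : measurable_fun setT (fun z => (w z).2) := measurableT_comp measurable_snd mw.
have mp1 : measurable_fun setT (fun z => (p z).1) := measurableT_comp measurable_fst mp.
have mp2 : measurable_fun setT (fun z => (p z).2) := measurableT_comp measurable_snd mp.
have ms : measurable_fun setT (fun z => v z + (w z).1 + (w z).2 - (p z).1 - (p z).2).
  by do 2 apply: measurable_funB => //; do 2 apply: measurable_funD => //.
have h c : measurable_fun setT c -> measurable_fun setT (fun z => f (t z) (x z) (c z)).
  by move=> mc; exact: measurable3_comp.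
rewrite /collision_integrand /interaction.
apply: measurable_funB; apply: measurable_funM.
- by apply: measurable_funM; [apply: measurable_funM|]; exact: h.
- by apply: measurable_funD; [apply: measurable_funD|]; apply: measurable_funM; exact: h.
- by apply: measurable_funM; [apply: measurable_funM|]; exact: h.
- by apply: measurable_funD; [apply: measurable_funD|]; apply: measurable_funM; exact: h.
Qed.

Lemma measurable_collision_kernel d (T : measurableType d) f
    (t x v : T -> R) (w u : T -> R * R) : measurable3 f ->
  measurable_fun setT t -> measurable_fun setT x -> measurable_fun setT v ->
  measurable_fun setT w -> measurable_fun setT u ->
  measurable_fun setT (fun z => collision_kernel f (t z) (x z) (v z) (w z) (u z)).
Proof.
move=> mf mt mx mv mw mu.
have mw1 : measurable_fun setT (fun z => (w z).1) := measurableT_comp measurable_fst mw.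
have mw2 : measurable_fun setT (fun z => (w z).2) := measurableT_comp measurable_snd mw.
have mu1 : measurable_fun setT (fun z => (u z).1) := measurableT_comp measurable_fst mu.
have mu2 : measurable_fun setT (fun z => (u z).2) := measurableT_comp measurable_snd mu.
have mr : measurable_fun setT (fun z => sphere_radius (v z) (w z).1 (w z).2).
  exact: measurable_sphere_radius.
have mc : measurable_fun setT (fun z => sphere_center (v z) (w z).1 (w z).2).
  by apply: measurable_funM => //; do 2 apply: measurable_funD => //.
apply: measurable_funM => //; apply: measurable_funM.
  apply: measurable_collision_integrand => //.
  by apply: measurable_fun_pair; apply: measurable_funD => //; apply: measurable_funM.
apply: (measurableT_comp measurable_inv); apply: measurable_funM => //.
exact: (measurableT_comp measurable_ellipse_grad).
Qed.

Lemma collision6E f (t x v : R) : measurable3 f ->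
  collision6 f t x v = \int[@plane_measure R]_w
    \int[ellipse_measure]_(u in ellipse) collision_kernel f t x v w u.
Proof.
move=> mf; apply: eq_Rintegral => w _.
rewrite delta_integral_resonance//.
exact: (@measurable_collision_integrand _ _ f (cst t) (cst x) (cst v) (cst w) id).
Qed.

Lemma measurable3_collision6 f : measurable3 f -> measurable3 (collision6 f).
Proof.
move=> mf; rewrite /measurable3.
under eq_fun do rewrite collision6E//.
pose K1 (z : (R * R * R) * (R * R)) :=
  \int[ellipse_measure]_(u in ellipse) collision_kernel f z.1.1.1 z.1.1.2 z.1.2 z.2 u.
apply: (@measurable_Rintegral_param _ _ _ _ _ plane_measure K1).
apply: (@measurable_Rintegral_param_in _ _ _ _ _ ellipse_measure (fun=> ellipse)
  (fun z => collision_kernel f z.1.1.1.1 z.1.1.1.2 z.1.1.2 z.1.2 z.2)).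
  rewrite [X in measurable X](_ : _ = setT `*` ellipse).
    by apply: measurableX => //; exact: measurable_ellipse.
  by apply/seteqP; split => [[z u]|[z u] []].
by apply: measurable_collision_kernel => //; measurable_projection.
Qed.

(** The Maxwellian carried by free transport to time [t]. *)
Definition weight (alpha beta t x v : R) : R :=
  expR (- (alpha * (x - t * v) ^+ 2 + beta * v ^+ 2)).

Lemma weight_itv01 alpha beta t x v : 0 <= alpha -> 0 <= beta ->
  0 <= weight alpha beta t x v <= 1.
Proof.
by move=> a0 b0; rewrite expR_ge0 expR_le1 oppr_le0 addr_ge0// mulr_ge0 ?sqr_ge0.
Qed.

(* Conservation of mass, momentum and energy on the resonant set. *)
Lemma weight_resonance alpha beta t x v v1 v2 p : resonance v v1 v2 p = 0 ->
  weight alpha beta t x p.1 * weight alpha beta t x p.2 *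
    weight alpha beta t x (v + v1 + v2 - p.1 - p.2) =
  weight alpha beta t x v * weight alpha beta t x v1 * weight alpha beta t x v2.
Proof.
rewrite resonanceE => h; rewrite /weight -!expRD; congr expR.
pose q := v ^+ 2 + v1 ^+ 2 + v2 ^+ 2 - p.1 ^+ 2 - p.2 ^+ 2 - (v + v1 + v2 - p.1 - p.2) ^+ 2.
apply/eqP; rewrite -subr_eq0; apply/eqP.
(* The parts of the exponents of degree 0 and 1 in the velocities cancel; [alpha * t ^+ 2 + beta]
   is, up to sign, the coefficient of [v ^+ 2]. *)
transitivity ((alpha * t ^+ 2 + beta) * q); first by rewrite /q; ring.
by rewrite /q h mulr0.
Qed.

(** Completing the square in [v] leaves the nonnegative remainder [alpha * beta * x ^+ 2 / k]. *)
Lemma weight_le_gaussian alpha beta t x v k : 0 <= alpha -> 0 < beta ->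
  k = beta + alpha * t ^+ 2 ->
  weight alpha beta t x v <= expR (- (k * (v - alpha * t * x / k) ^+ 2)).
Proof.
move=> a0 b0 kE; have k0 : 0 < k by rewrite kE ltr_wpDr// mulr_ge0 ?sqr_ge0.
rewrite /weight ler_expR lerN2 -subr_ge0.
rewrite (_ : _ - _ = alpha * beta * x ^+ 2 / k).
  apply: divr_ge0; last exact: ltW.
  by apply: mulr_ge0; [exact: mulr_ge0 a0 (ltW b0)|exact: sqr_ge0].
by move: k0; rewrite kE => k0; field; rewrite gt_eqF.
Qed.

Lemma comparable_at_collision_kernel alpha beta t x v (F D : R) f g w u :
  0 <= alpha -> 0 <= beta -> 0 <= F -> 0 <= D ->
  (forall v, comparable_at F D (weight alpha beta t x v) (f t x v) (g t x v)) ->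
  ellipse u ->
  comparable_at (6 * F ^+ 5) (30 * F ^+ 4 * D)
    (weight alpha beta t x v * weight alpha beta t x w.1 * weight alpha beta t x w.2)
    (collision_kernel f t x v w u) (collision_kernel g t x v w u).
Proof.
move=> a0 b0 F0 D0 fg Eu; rewrite /collision_kernel.
set r := sphere_radius _ _ _; set p := resonant_point _ _ _ _.
(* The prefactor is 0 or the inverse of [ellipse_grad u], hence at most 1. *)
have rE y : r * (y / (r * ellipse_grad u)) = r / (r * ellipse_grad u) * y.
  by rewrite [RHS]mulrAC mulrA.
rewrite !rE; apply: comparable_at_scale.
  have g1 := ellipse_grad_ge1 Eu.
  have [->|r0] := eqVneq r 0; first by rewrite mul0r normr0.
  rewrite invfM mulrA mulfV// mul1r ger0_norm ?invr_ge0 ?(le_trans ler01)//.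
  by rewrite invf_le1// (lt_le_trans ltr01).
pose W := weight alpha beta t x.
apply: (@comparable_at_interaction _ F D (W v) (W w.1) (W w.2) (W p.1) (W p.2)
  (W (v + w.1 + w.2 - p.1 - p.2))) => //; try exact: weight_itv01.
apply: weight_resonance.
by rewrite resonance_point Eu subrr mulr0.
Qed.

Definition ellipse_mass : R := fine (ellipse_measure (@ellipse R)).

Lemma comparable_at_collision6 alpha beta t x v (F D : R) f g :
  0 <= alpha -> 0 < beta -> 0 <= F -> 0 <= D -> measurable3 f -> measurable3 g ->
  (forall v, comparable_at F D (weight alpha beta t x v) (f t x v) (g t x v)) ->
  comparable_at (6 * F ^+ 5) (30 * F ^+ 4 * D)
    (ellipse_mass * pi * weight alpha beta t x v * (beta + alpha * t ^+ 2)^-1)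
    (collision6 f t x v) (collision6 g t x v).
Proof.
move=> a0 b0 F0 D0 mf mg fg; rewrite !collision6E//.
pose k := beta + alpha * t ^+ 2.
have k0 : 0 < k by rewrite ltr_wpDr// mulr_ge0 ?sqr_ge0.
pose c := alpha * t * x / k.
pose G w : R := expR (- (k * (w - c) ^+ 2)).
(* Bound for the inner integral: the weight at [v], the length of the ellipse, and a Gaussian in
   each of [v1], [v2] with common centre [c]. *)
pose A (w : R * R) : R := weight alpha beta t x v * ellipse_mass * (G w.1 * G w.2).
have F60 : 0 <= 6 * F ^+ 5 by rewrite mulr_ge0// exprn_ge0.
have D30 : 0 <= 30 * F ^+ 4 * D by rewrite !mulr_ge0// exprn_ge0.
have W0 y : 0 <= weight alpha beta t x y by exact: expR_ge0.
have m0 : 0 <= ellipse_mass by rewrite fine_ge0// measure_ge0.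
have mK h : measurable3 h -> measurable_fun setT (fun w =>
    \int[ellipse_measure]_(u in ellipse) collision_kernel h t x v w u).
  move=> mh.
  apply: (@measurable_Rintegral_param_in _ _ _ _ _ ellipse_measure (fun=> ellipse)
    (fun z => collision_kernel h t x v z.1 z.2)).
    rewrite [X in measurable X](_ : _ = setT `*` ellipse).
      by apply: measurableX => //; exact: measurable_ellipse.
    by apply/seteqP; split => [[z u]|[z u] []].
  exact: (@measurable_collision_kernel _ _ h (cst t) (cst x) (cst v) fst snd).
have inner w : comparable_at (6 * F ^+ 5) (30 * F ^+ 4 * D) (A w)
    (\int[ellipse_measure]_(u in ellipse) collision_kernel f t x v w u)
    (\int[ellipse_measure]_(u in ellipse) collision_kernel g t x v w u).
  pose B := weight alpha beta t x v * weight alpha beta t x w.1 * weight alpha beta t x w.2.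
  apply: (@comparable_at_weight _ _ _ (\int[ellipse_measure]_(u in ellipse) B)) => //.
    rewrite Rintegral_cst; last exact: measurable_ellipse.
    rewrite -/ellipse_mass /B /A.
    rewrite (_ : _ * ellipse_mass = weight alpha beta t x v * ellipse_mass *
      (weight alpha beta t x w.1 * weight alpha beta t x w.2)); last by ring.
    apply: ler_wpM2l; first exact: mulr_ge0.
    by apply: ler_pM => //; exact: weight_le_gaussian.
  have mk h : measurable3 h -> measurable_fun ellipse (collision_kernel h t x v w).
    move=> mh; apply: measurable_funTS.
    exact: (@measurable_collision_kernel _ _ h (cst t) (cst x) (cst v) (cst w) id).
  apply: comparable_at_Rintegral; [exact: measurable_ellipse|exact: mk|exact: mk| |].
    exact: (finite_measure_integrable_cst ellipse_measure B measurable_ellipse).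
  move=> u Eu; apply: comparable_at_collision_kernel => //; exact: ltW.
have mG : measurable_fun setT G.
  apply: (measurableT_comp (@measurable_expR R)); apply: measurableT_comp => //.
  by apply: measurable_funM => //; apply: measurable_funX; exact: measurable_funB.
have iG : (@plane_measure R).-integrable setT (EFin \o (fun w => G w.1 * G w.2)).
  apply/integrableP; split.
    apply/measurable_EFinP; apply: measurable_funM.
      exact: (measurableT_comp mG measurable_fst).
    exact: (measurableT_comp mG measurable_snd).
  under eq_integral do rewrite /= ger0_norm ?mulr_ge0 ?expR_ge0//.
  by rewrite [X in (X < _)%E](gaussian_integral2 c k0) ltry.
have intA : \int[@plane_measure R]_w A w =
    ellipse_mass * pi * weight alpha beta t x v * k^-1.
  rewrite /A RintegralZl// /Rintegral [X in fine X](gaussian_integral2 c k0)/=.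
  by ring.
rewrite -/k -intA; apply: comparable_at_Rintegral => //; try exact: mK.
rewrite (_ : EFin \o A = fun w => ((weight alpha beta t x v * ellipse_mass)%:E *
  (EFin \o (fun w => G w.1 * G w.2)%R) w)%E) //.
exact: integrableZl.
Qed.

End collision.

(** * Fixed points in a weighted sup norm *)

Section weighted_contraction.
Context {R : realType}.

Lemma le0_geometric (x c : R) : (forall n, x <= c * 2^-1 ^+ n) -> x <= 0.
Proof.
move=> h; have half1 : `|2^-1 : R| < 1 by rewrite ger0_norm// invf_lt1// ltr1n.
apply: (ler_cvg_to (cvg_cst x) (cvg_geometric c half1)).
exact: nearW.
Qed.

Lemma cvg_geometric_dist (u : nat -> R) (l c : R) :
  (forall n, `|l - u n| <= c * 2^-1 ^+ n) -> u n @[n --> \oo] --> l.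
Proof.
move=> h; have half1 : `|2^-1 : R| < 1 by rewrite ger0_norm// invf_lt1// ltr1n.
have geo := cvg_geometric c half1.
apply: (@squeeze_cvgr _ _ _ _ (fun n => l - geometric c 2^-1 n)
  (fun n => l + geometric c 2^-1 n)).
- by apply: nearW => n; rewrite -ler_distlC; exact: h.
- by rewrite -[X in _ --> X]subr0; apply: cvgB geo; exact: cvg_cst.
- by rewrite -[X in _ --> X]addr0; apply: cvgD geo; exact: cvg_cst.
Qed.

(** With [e n = 2 * c * 2^-1 ^+ n] the intervals of centre [u n] and radius [e n] are nested; the
    limit is the supremum of their left ends. *)
Lemma geometric_increments_limit (u : nat -> R) (c : R) :
  (forall n, `|u n.+1 - u n| <= c * 2^-1 ^+ n) ->
  exists l, forall n, `|l - u n| <= 2 * c * 2^-1 ^+ n.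
Proof.
move=> h; pose e n := 2 * c * 2^-1 ^+ n.
have eS n : e n = e n.+1 + c * 2^-1 ^+ n by rewrite /e exprS; field.
have nd n k : u n - e n <= u (n + k)%N - e (n + k)%N.
  elim: k => [|k IH]; first by rewrite addn0.
  rewrite addnS; apply: le_trans IH _.
  by have := h (n + k)%N; rewrite ler_norml => /andP[h1 _]; rewrite (eS (n + k)%N); lra.
have ni n k : u (n + k)%N + e (n + k)%N <= u n + e n.
  elim: k => [|k IH]; first by rewrite addn0.
  rewrite addnS; apply: le_trans IH.
  by have := h (n + k)%N; rewrite ler_norml => /andP[_ h1]; rewrite (eS (n + k)%N); lra.
have c0 : 0 <= c by have := h 0%N; rewrite expr0 mulr1; apply: le_trans.
have e0 n : 0 <= e n by rewrite !mulr_ge0// exprn_ge0.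
pose A := range (fun n => u n - e n).
have ubA n : ubound A (u n + e n).
  move=> _ [m _ <-]; have := nd m n; have := ni n m; rewrite (addnC n m).
  by have := e0 (m + n)%N; lra.
have A0 : A !=set0 by exists (u 0%N - e 0%N), 0%N.
exists (sup A) => n; rewrite ler_distlC; apply/andP; split.
  by rewrite lerBlDr; apply: ge_sup => //; exact: ubA.
rewrite -lerBlDr; apply: ub_le_sup; last by exists n.
by exists (u 0%N + e 0%N); exact: ubA.
Qed.

(** Banach's fixed point argument with ratio 1/2, carried out pointwise: the iterates of the centre
    [c] converge at each point at a geometric rate times [W], so closure of [P] under pointwise
    limits is enough. *)
Lemma weighted_contraction (X : Type) (W c : X -> R) (r : R)
    (P : set (X -> R)) (Phi : (X -> R) -> X -> R) :
  (forall x, 0 <= W x) ->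
  let B := P `&` [set f | forall x, `|f x - c x| <= r * W x] in
  B c -> (forall f, B f -> B (Phi f)) ->
  (forall f g D, B f -> B g -> 0 <= D ->
     (forall x, `|f x - g x| <= D * W x) ->
     forall x, `|Phi f x - Phi g x| <= D / 2 * W x) ->
  (forall (u : nat -> X -> R) f, (forall n, P (u n)) ->
     (forall x, u n x @[n --> \oo] --> f x) -> P f) ->
  exists! f, B f /\ Phi f = f.
Proof.
move=> W0 B Bc BPhi contr closedP.
have r0 x : 0 <= r * W x by have := Bc.2 x; rewrite subrr normr0.
(* [r] may be negative where [W] vanishes identically; the contraction hypothesis asks for a
   nonnegative constant. *)
pose r' := Num.max r 0.
have r'0 : 0 <= r' by rewrite le_max lexx orbT.
have rr' x : r * W x <= r' * W x by rewrite ler_wpM2r// le_max lexx.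
pose u n := iter n Phi c.
have Bu n : B (u n) by elim: n => //= n; exact: BPhi.
have du n x : `|u n.+1 x - u n x| <= r' * 2^-1 ^+ n * W x.
  elim: n x => [x|n IH x].
    by rewrite expr0 mulr1 (le_trans _ (rr' x))//; exact: (Bu 1%N).2.
  rewrite exprSr mulrA; apply: (contr (u n.+1) (u n)) => //.
  by rewrite mulr_ge0// exprn_ge0.
have lim x : exists l, forall n, `|l - u n x| <= 2 * (r' * W x) * 2^-1 ^+ n.
  by apply: geometric_increments_limit => n; rewrite mulrAC.
pose f x := projT1 (cid (lim x)).
have fu x n : `|f x - u n x| <= 2 * (r' * W x) * 2^-1 ^+ n.
  exact: (projT2 (cid (lim x))).
have Bf : B f.
  split.
    apply: (closedP u) => [n|x]; first exact: (Bu n).1.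
    exact: cvg_geometric_dist (fu x).
  move=> x; rewrite -subr_le0; apply: (@le0_geometric _ (2 * (r' * W x))) => n.
  have := ler_normD (f x - u n x) (u n x - c x); rewrite subrKA.
  by have := fu x n; have := (Bu n).2 x; lra.
have Phif : Phi f = f.
  apply/funext => x; apply/eqP; rewrite -subr_eq0 -normr_le0.
  apply: (@le0_geometric _ (2 * (r' * W x))) => n.
  have h1 : `|Phi f x - u n.+1 x| <= 2 * r' * 2^-1 ^+ n / 2 * W x.
    apply: (contr f (u n)) => //; first by rewrite !mulr_ge0// exprn_ge0.
    by move=> y; rewrite mulrAC -(mulrA 2); exact: fu.
  have := ler_normD (Phi f x - u n.+1 x) (u n.+1 x - f x); rewrite subrKA.
  have := fu x n.+1; rewrite distrC exprS; move: h1.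
  set q := 2^-1 ^+ n; lra.
exists f; split=> // g [Bg Phig].
(* Two fixed points in [B] are at weighted distance at most [2 * r'], and each application of [Phi]
   halves this bound. *)
have dfg n x : `|g x - f x| <= 2 * r' * 2^-1 ^+ n * W x.
  elim: n x => [x|n IH x].
    rewrite expr0 mulr1; have := ler_normD (g x - c x) (c x - f x).
    rewrite subrKA (distrC (c x)).
    by have := Bg.2 x; have := Bf.2 x; have := rr' x; lra.
  rewrite -{1}Phig -{1}Phif exprSr mulrA; apply: (contr g f) => //.
  by rewrite !mulr_ge0// exprn_ge0.
apply/funext => x; apply/eqP; rewrite eq_sym -subr_eq0 -normr_le0.
apply: (@le0_geometric _ (2 * r' * W x)) => n.
by rewrite mulrAC dfg.
Qed.
End weighted_contraction.

(** * The Duhamel map *)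

Section duhamel.
Context {R : realType}.
Local Notation leb := (@lebesgue_measure R).
Implicit Types (f g : R -> R -> R -> R).

Lemma free_profileE f t x v : free_profile f t x v = f t (x + t * v) v.
Proof. by rewrite /free_profile /transport mulNr opprK. Qed.

Lemma maxwellianE alpha beta (x v : R) :
  maxwellian alpha beta x v = weight alpha beta 0 x v.
Proof.
rewrite /maxwellian /weight !real_normK ?num_real// mul0r subr0.
by rewrite mulNr opprD.
Qed.

Lemma weight_free alpha beta s t (x v : R) :
  weight alpha beta s (x + (s - t) * v) v = weight alpha beta t x v.
Proof.
rewrite /weight (_ : x + (s - t) * v - s * v = x - t * v)//.
by rewrite mulrBl -addrA addrAC subrr add0r.
Qed.

Definition collision_time_integral f (t x v : R) : R :=
  oriented_integral 0 t (fun s => transport (- s) (collision6 f) s x v).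

Definition duhamel (f0 : R -> R -> R) f (t x v : R) : R :=
  f0 (x - t * v) v + collision_time_integral f t (x - t * v) v.

Lemma measurable3_duhamel (f0 : R -> R -> R) f :
  measurable_fun setT (fun xv : R * R => f0 xv.1 xv.2) -> measurable3 f ->
  measurable3 (duhamel f0 f).
Proof.
move=> mf0 mf; have mC := measurable3_collision6 mf.
pose T := (R * R * R)%type.
have mt : measurable_fun setT (fun p : T => p.1.1) by measurable_projection.
have mx : measurable_fun setT (fun p : T => p.1.2) by measurable_projection.
have mv : measurable_fun setT (fun p : T => p.2) by measurable_projection.
have my : measurable_fun setT (fun p : T => p.1.2 - p.1.1 * p.2).
  by apply: measurable_funB => //; exact: measurable_funM.
apply: measurable_funD.
  exact: (measurableT_comp mf0 (measurable_fun_pair my mv)).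
pose h (z : T * R) := collision6 f z.2 (z.1.1.2 - z.1.1.1 * z.1.2 - - z.2 * z.1.2) z.1.2.
have ms : measurable_fun setT (fun z : T * R => z.2) by measurable_projection.
have mzt : measurable_fun setT (fun z : T * R => z.1.1.1) by measurable_projection.
have mh : measurable_fun setT h.
  apply: (measurable3_comp mC) => //; last by measurable_projection.
  apply: measurable_funB.
    exact: (measurableT_comp my measurable_fst).
  apply: measurable_funM; last by measurable_projection.
  exact: measurableT_comp.
(* The interval varies with the parameter; the region between the graphs of [a] and [b] is
   measurable. *)
have key (a b : T -> R) : measurable_fun setT a -> measurable_fun setT b ->
    measurable_fun setT (fun p : T => \int[leb]_(s in `[a p, b p]) h (p, s)).
  move=> ma mb.
  have := @measurable_Rintegral_param_in _ _ _ _ _ leb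
    (fun p : T => `[a p, b p]%classic) h.
  apply => //.
  have ma' : measurable_fun setT (fun z : T * R => a z.1).
    exact: (measurableT_comp ma measurable_fst).
  have mb' : measurable_fun setT (fun z : T * R => b z.1).
    exact: (measurableT_comp mb measurable_fst).
  rewrite [X in measurable X](_ : _ =
    (setT `&` [set z : T * R | a z.1 <= z.2]) `&`
    (setT `&` [set z : T * R | z.2 <= b z.1])).
    by apply: measurableI; exact: measurable_fun_le.
  apply/seteqP; split => [z|z [[_ az] [_ zb]]] /=; rewrite in_itv/= ?az//.
  by move=> /andP[].
rewrite /collision_time_integral /oriented_integral.
apply: measurable_fun_ifT.
- exact: measurable_fun_ler.
- exact: (key (cst 0)).
- by apply: measurableT_comp => //; exact: (key _ (cst 0)).
Qed.

Lemma duhamel_fixed_pointP (f0 : R -> R -> R) f :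
  (forall t x v, free_profile f t x v = f0 x v + collision_time_integral f t x v) <->
  duhamel f0 f = f.
Proof.
split => [h|h t x v].
  apply/funext => t; apply/funext => x; apply/funext => v.
  by rewrite /duhamel -h free_profileE subrK.
by rewrite free_profileE -{1}h /duhamel addrK.
Qed.

(** Length of the ellipse, times [pi] from the planar Gaussian, times the Lorentzian bound in
    time. *)
Definition time_constant alpha beta : R :=
  ellipse_mass * pi * (pi / Num.sqrt (alpha * beta)).

Lemma comparable_at_collision_time_integral alpha beta (F D : R) f g t x v :
  0 < alpha -> 0 < beta -> 0 <= F -> 0 <= D -> measurable3 f -> measurable3 g ->
  (forall t x v, comparable_at F D (weight alpha beta t x v) (f t x v) (g t x v)) ->
  comparable_at (6 * F ^+ 5) (30 * F ^+ 4 * D)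
    (time_constant alpha beta * weight alpha beta 0 x v)
    (collision_time_integral f t x v) (collision_time_integral g t x v).
Proof.
move=> a0 b0 F0 D0 mf mg fg.
have F60 : 0 <= 6 * F ^+ 5 by rewrite mulr_ge0// exprn_ge0.
have D30 : 0 <= 30 * F ^+ 4 * D by rewrite !mulr_ge0// exprn_ge0.
have m0 : 0 <= @ellipse_mass R by rewrite fine_ge0// measure_ge0.
pose c := ellipse_mass * pi * weight alpha beta 0 x v.
have c0 : 0 <= c by rewrite !mulr_ge0// ?pi_ge0 ?expR_ge0.
have mC h : measurable3 h ->
    measurable_fun setT (fun s : R => transport (- s) (collision6 h) s x v).
  move=> mh; apply: (measurable3_comp (measurable3_collision6 mh)) => //.
  by apply: measurable_funB => //; apply: measurable_funM => //.
have key a b : a <= b -> comparable_at (6 * F ^+ 5) (30 * F ^+ 4 * D)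
    (time_constant alpha beta * weight alpha beta 0 x v)
    (\int[leb]_(s in `[a, b]) transport (- s) (collision6 f) s x v)
    (\int[leb]_(s in `[a, b]) transport (- s) (collision6 g) s x v).
  move=> ab; have [iL leL] := lorentzian_integral a0 b0 ab.
  apply: (@comparable_at_weight _ _ _
    (\int[leb]_(s in `[a, b]) (c * (beta + alpha * s ^+ 2)^-1))) => //.
    rewrite RintegralZl//.
    apply: (@le_trans _ _ (c * (pi / Num.sqrt (alpha * beta)))).
      exact: ler_wpM2l.
    by rewrite /time_constant /c mulrAC.
  apply: comparable_at_Rintegral => //.
  - by apply: measurable_funTS; exact: mC.
  - by apply: measurable_funTS; exact: mC.
  - rewrite (_ : EFin \o _ =
      fun s => (c%:E * (EFin \o (fun s => (beta + alpha * s ^+ 2)^-1)%R) s)%E)//.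
    exact: integrableZl.
  - move=> s _; rewrite /transport mulNr opprK.
    (* Along [x + s * v] the weight at time [s] does not depend on [s], so it leaves the time
       integral. *)
    rewrite /c -(weight_free alpha beta s 0) subr0.
    by apply: comparable_at_collision6 => //; exact: ltW.
rewrite /collision_time_integral /oriented_integral.
have [t0|t0] := leP 0 t; first exact: key.
exact/comparable_atN/key/ltW.
Qed.

End duhamel.

(** * Mild solutions near the Maxwellian *)

Section solutions.
Context {R : realType}.
Implicit Types (f g : R -> R -> R -> R).

Lemma wnorm_leP alpha beta (g : R -> R -> R) (c : R) :
  (wnorm alpha beta g <= c%:E)%E <->
  forall x v, `|g x v| <= c * weight alpha beta 0 x v.
Proof.
have E x v : (`|g x v| * expR (alpha * `|x| ^+ 2 + beta * `|v| ^+ 2) <= c) =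
    (`|g x v| <= c * weight alpha beta 0 x v).
  rewrite !real_normK ?num_real// /weight expRN mul0r subr0.
  by rewrite ler_pdivlMr ?expR_gt0.
split=> [h x v|h].
  rewrite -E -lee_fin; apply: le_trans h.
  by apply: ereal_sup_ubound; exists (x, v).
by apply: ge_ereal_sup => _ [[x v] _ <-]; rewrite lee_fin E.
Qed.

Lemma wnorm_sup_leP alpha beta g (c : R) :
  (wnorm_sup alpha beta g <= c%:E)%E <->
  forall t x v, `|g t x v| <= c * weight alpha beta 0 x v.
Proof.
split=> [h t|h].
  by apply/wnorm_leP; apply: le_trans h; apply: ereal_sup_ubound; exists t.
by apply: ge_ereal_sup => _ [t _ <-]; apply/wnorm_leP.
Qed.

(** At each time the shear taking [x] to [x - t * v] turns the free profile into [f] and the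
    Maxwellian into the transported weight. *)
Lemma near_maxwellianP alpha beta f (r : R) :
  (wnorm_sup alpha beta (fun t x v =>
     (free_profile f t x v - maxwellian alpha beta x v)%R) <= r%:E)%E <->
  forall t x v, `|f t x v - weight alpha beta t x v| <= r * weight alpha beta t x v.
Proof.
split=> [/wnorm_sup_leP h t x v|h].
  have := h t (x - t * v) v.
  rewrite free_profileE subrK maxwellianE.
  by rewrite -{1 2}(weight_free alpha beta 0 t) sub0r mulNr.
apply/wnorm_sup_leP => t x v; rewrite free_profileE maxwellianE.
have := h t (x + t * v) v.
by rewrite -(weight_free alpha beta 0 t (x + t * v)) sub0r mulNr addrK.
Qed.

Lemma near_maxwellian_bound alpha beta f (r : R) t x v :
  `|f t x v - weight alpha beta t x v| <= r * weight alpha beta t x v ->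
  `|f t x v| <= (1 + r) * weight alpha beta t x v.
Proof.
move=> h; have := ler_normD (f t x v - weight alpha beta t x v) (weight alpha beta t x v).
have w0 : 0 <= weight alpha beta t x v by exact: expR_ge0.
by rewrite subrK (ger0_norm w0); lra.
Qed.

(** Reduces the problem to a fixed point: membership in [in_Linfty_M] follows from the closeness
    bound, which gives norm at most [1 + r]. *)
Lemma mild_solution_near_maxwellianP alpha beta (f0 : R -> R -> R) f (r : R) :
  mild_solution alpha beta f0 f /\
    (wnorm_sup alpha beta (fun t x v =>
       (free_profile f t x v - maxwellian alpha beta x v)%R) <= r%:E)%E <->
  [/\ measurable3 f,
      forall t x v, `|f t x v - weight alpha beta t x v| <= r * weight alpha beta t x v &
      duhamel f0 f = f].
Proof.
split=> [[[mf _ /duhamel_fixed_pointP ff] /near_maxwellianP fr] //|[mf fr ff]].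
split; last exact/near_maxwellianP.
split => //; last exact/duhamel_fixed_pointP.
split.
  rewrite /measurable3; under eq_fun do rewrite free_profileE.
  apply: measurable3_comp => //; measurable_projection.
  by apply: measurable_funD => //; [|apply: measurable_funM]; measurable_projection.
apply: (@le_lt_trans _ _ (1 + r)%:E); last exact: ltry.
apply/wnorm_sup_leP => t x v; rewrite free_profileE.
have := near_maxwellian_bound (fr t (x + t * v) v).
by rewrite -(weight_free alpha beta 0 t (x + t * v)) sub0r mulNr addrK.
Qed.

(** The smallness hypothesis makes the Duhamel map 1/256-Lipschitz on the ball, well below the ratio
    1/2 asked by [weighted_contraction], and [1 / 6 <= Rp] keeps the ball invariant. *)
Lemma unique_mild_solution alpha beta (Rp : R) (f0 : R -> R -> R) :
  0 < alpha -> 0 < beta -> 1 / 6 <= Rp ->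
  30 * time_constant alpha beta * (1 + 2 * Rp) ^+ 4 <= 256^-1 ->
  in_M alpha beta f0 ->
  (wnorm alpha beta (fun x v => (f0 x v - maxwellian alpha beta x v)%R) < Rp%:E)%E ->
  exists! f, [/\ measurable3 f,
      forall t x v, `|f t x v - weight alpha beta t x v|
        <= 2 * Rp * weight alpha beta t x v &
      duhamel f0 f = f].
Proof.
move=> a0 b0 Rp6 small [mf0 _] /ltW/wnorm_leP f0M.
pose curry3 (F : R * R * R -> R) t x v := F (t, x, v).
pose W (p : R * R * R) := weight alpha beta p.1.1 p.1.2 p.2.
pose Phi (F : R * R * R -> R) (p : R * R * R) := duhamel f0 (curry3 F) p.1.1 p.1.2 p.2.
pose P : set (R * R * R -> R) := [set F | measurable_fun setT F].
set q := 1 + 2 * Rp in small.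
have q0 : 0 <= q by rewrite /q; lra.
have W0 p : 0 <= W p by exact: expR_ge0.
have m3 F : P F -> measurable3 (curry3 F).
  by rewrite /P/= /measurable3; congr measurable_fun; apply/funext => -[[]].
have tc0 : 0 <= time_constant alpha beta.
  rewrite /time_constant !mulr_ge0 ?pi_ge0 ?divr_ge0 ?sqrtr_ge0 ?pi_ge0//.
  by rewrite fine_ge0// measure_ge0.
have wE t x v : weight alpha beta 0 (x - t * v) v = weight alpha beta t x v.
  by rewrite -(weight_free alpha beta 0 t) sub0r mulNr.
have cmp F G D t x v : P F -> P G -> 0 <= D ->
    (forall p, `|F p - W p| <= 2 * Rp * W p) ->
    (forall p, `|G p - W p| <= 2 * Rp * W p) ->
    (forall p, `|F p - G p| <= D * W p) ->
    comparable_at (6 * q ^+ 5) (30 * q ^+ 4 * D)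
      (time_constant alpha beta * weight alpha beta t x v)
      (collision_time_integral (curry3 F) t (x - t * v) v)
      (collision_time_integral (curry3 G) t (x - t * v) v).
  move=> PF PG D0 FW GW FG; rewrite -wE.
  apply: comparable_at_collision_time_integral => //; [exact: m3..|].
  move=> t' x' v'; split; last exact: (FG (t', x', v')).
    exact: (near_maxwellian_bound (FW (t', x', v'))).
  exact: (near_maxwellian_bound (GW (t', x', v'))).
have [||||F [[[PF FW] FE] Funiq]] :=
  @weighted_contraction R (R * R * R)%type W W (2 * Rp) P Phi W0.
- split; last by move=> p /=; rewrite subrr normr0 mulr_ge0//; lra.
  rewrite /P/= /W /weight; apply: (measurableT_comp (@measurable_expR R)).
  apply: measurableT_comp => //; apply: measurable_funD; apply: measurable_funM => //;
    apply: measurable_funX; measurable_projection.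
  apply: measurable_funB; [|apply: measurable_funM]; measurable_projection.
- move=> F [PF FW]; split.
    exact: (measurable3_duhamel mf0 (m3 _ PF)).
  move=> [[t x] v]; rewrite /Phi /W/= /duhamel.
  (* Comparing [F] with itself, with [D = 0], extracts the size bound alone. *)
  have FF p : `|F p - F p| <= 0 * W p by rewrite subrr normr0 mul0r.
  have [h _ _] := cmp F F 0 t x v PF PF (lexx 0) FW FW FF.
  have := f0M (x - t * v) v; rewrite maxwellianE !wE.
  set w := weight alpha beta t x v in h *; set y := f0 _ _.
  set T := collision_time_integral _ _ _ _ in h * => hy.
  have w0 : 0 <= w by exact: expR_ge0.
  have hT : `|T| <= Rp * w.
    apply: le_trans h _.
    (* The size bound is the Lipschitz constant times [q / 5], hence at most [q / 1280], which is
       below [Rp] because [1 / 6 <= Rp]. *)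
    rewrite (_ : 6 * q ^+ 5 * (time_constant alpha beta * w) =
      30 * time_constant alpha beta * q ^+ 4 * (q / 5 * w)); last by field.
    apply: (@le_trans _ _ (256^-1 * (q / 5 * w))).
      by apply: ler_wpM2r small; rewrite mulr_ge0// divr_ge0.
    by rewrite !mulrA ler_wpM2r// /q; lra.
  have := ler_normD (y - w) T; rewrite addrAC.
  by lra.
- move=> F G D [PF FW] [PG GW] D0 FG [[t x] v]; rewrite /Phi /W/= /duhamel.
  have [_ _ h] := cmp F G D t x v PF PG D0 FW GW FG.
  rewrite opprD addrACA subrr add0r; apply: (le_trans h).
  rewrite (_ : 30 * q ^+ 4 * D * (time_constant alpha beta * weight alpha beta t x v) =
    30 * time_constant alpha beta * q ^+ 4 * (D * weight alpha beta t x v)); last by ring.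
  apply: (@le_trans _ _ (256^-1 * (D * weight alpha beta t x v))).
    by apply: ler_wpM2r small; rewrite mulr_ge0// expR_ge0.
  rewrite mulrA ler_wpM2r// ?expR_ge0//.
  by lra.
- by move=> u F Pu uF; apply: measurable_fun_cvg Pu _ => p _; exact: uF.
exists (curry3 F); split.
  split; [exact: m3|by move=> t x v; exact: (FW (t, x, v))|].
  apply/funext => t; apply/funext => x; apply/funext => v.
  exact: (congr1 (fun G => G (t, x, v)) FE).
move=> g [mg gW gE].
have gF : F = fun p => g p.1.1 p.1.2 p.2.
  apply: Funiq; split.
    by split; [exact: mg|move=> p; exact: gW].
  by apply/funext => p; rewrite /Phi /curry3 [X in duhamel _ X](_ : _ = g) ?gE.
by rewrite gF.
Qed.

End solutions.

(** * Constants *)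

Section constants.
Context {R : realType}.

(** The root of 2 cancels the prefactor of [C1_beta], 30 is the Lipschitz factor of the interaction,
    and [+ 1] gives positivity from [0 <= ellipse_mass]. *)
Definition C1_value : R := 2 `^ 2^-1 * (30 * (ellipse_mass * pi * pi + 1)).

Lemma ellipse_mass_ge0 : 0 <= @ellipse_mass R.
Proof. by rewrite fine_ge0// measure_ge0. Qed.

Lemma C1_value_gt0 : 0 < C1_value.
Proof.
rewrite mulr_gt0 ?powR_gt0// mulr_gt0// ltr_wpDl//.
by rewrite !mulr_ge0 ?pi_ge0 ?ellipse_mass_ge0.
Qed.

Lemma C1_beta_gt0 (beta : R) : 0 < beta -> 0 < C1_beta C1_value beta.
Proof.
move=> b0; apply: mulr_gt0; last by rewrite ltr_wpDl// invr_ge0 ltW.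
by apply: mulr_gt0; [exact: powR_gt0|exact: C1_value_gt0].
Qed.

Lemma time_constant_le (alpha beta : R) : 0 < alpha -> 0 < beta ->
  30 * time_constant alpha beta <= C1_beta C1_value beta * alpha `^ (- 2^-1).
Proof.
move=> a0 b0; rewrite /C1_beta /C1_value powRN.
rewrite (powRN alpha) (powR12_sqrt (ltW a0)) mulKf; last by rewrite gt_eqF// powR_gt0.
rewrite /time_constant sqrtrM ?(ltW a0)//.
set m := ellipse_mass; set a := Num.sqrt alpha; set b := Num.sqrt beta.
have m0 : 0 <= m * pi * pi by rewrite !mulr_ge0 ?pi_ge0 ?ellipse_mass_ge0.
have sa0 : 0 < a by rewrite sqrtr_gt0.
have sb0 : 0 < b by rewrite sqrtr_gt0.
have bE : beta = b ^+ 2 by rewrite sqr_sqrtr// ltW.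
rewrite (_ : 30 * (m * pi * (pi / (a * b))) = 30 * (m * pi * pi) * b^-1 / a); last first.
  by field; rewrite !gt_eqF.
rewrite ler_wpM2r ?invr_ge0 ?(ltW sa0)//.
have -> : beta^-1 = b^-1 ^+ 2 by rewrite bE exprVn.
have ib0 : 0 <= b^-1 by rewrite invr_ge0 ltW.
apply: ler_pM => //; [by rewrite mulr_ge0|by rewrite ler_wpM2l//; lra|].
(* The inequality [b^-1 <= b^-1 ^+ 2 + 1] trades the inverse root of [beta] for the factor
   [beta^-1 + 1]. *)
by have := sqr_ge0 (b^-1 - 1); nra.
Qed.

Lemma powR_quarter_expr (x : R) : 0 < x -> (x `^ (1 / 4)) ^+ 4 = x.
Proof.
move=> x0; rewrite -powR_mulrn ?powR_ge0// -powRrM.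
by rewrite (_ : 1 / 4 * 4%:R = 1) ?powRr1 ?ltW//; field.
Qed.

Lemma powR_eighth_expr (x : R) : 0 < x -> (x `^ (1 / 8)) ^+ 4 = x `^ 2^-1.
Proof.
move=> x0; rewrite -powR_mulrn ?powR_ge0// -powRrM.
by congr powR; field.
Qed.

End constants.

Theorem theorem2p4 (R : realType) :
  exists C1 : R, 0 < C1 /\
  forall alpha beta Rp : R, 0 < alpha -> 0 < beta ->
  C1_beta C1 beta * alpha `^ (- 2^-1) < (3 / 16) ^+ 4 ->
  0 < Rp ->
  1 / 6 <= Rp ->
  Rp <= alpha `^ (1 / 8) / (2 ^+ 3 * (C1_beta C1 beta) `^ (1 / 4)) - 1 / 2 ->
  forall f0 : R -> R -> R,
  in_M alpha beta f0 ->
  (wnorm alpha beta (fun x v => (f0 x v - maxwellian alpha beta x v)%R)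
    < Rp%:E)%E ->
  let solution f := mild_solution alpha beta f0 f /\
    (wnorm_sup alpha beta (fun t x v =>
       (free_profile f t x v - maxwellian alpha beta x v)%R) <= (2 * Rp)%:E)%E in
  (exists! f : R -> R -> R -> R, solution f) /\
  (1 / 2 ^+ 12 < C1_beta C1 beta * alpha `^ (- 2^-1) ->
   forall f : R -> R -> R -> R, solution f ->
   forall t x v, 0 <= f t x v).
Proof.
exists C1_value; split; first exact: C1_value_gt0.
move=> alpha beta Rp a0 b0 _ _ Rp6 RpU f0 f0M f0near solution.
have K0 := C1_beta_gt0 b0; have tcK := time_constant_le a0 b0.
set K := C1_beta _ _ in K0 tcK RpU *.
pose k := K `^ (1 / 4); pose a := alpha `^ (1 / 8); pose y := k / a.
have k0 : 0 < k by exact: powR_gt0.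
have a80 : 0 < a by exact: powR_gt0.
have y0 : 0 < y by exact: divr_gt0.
have CE : K * alpha `^ (- 2^-1) = y ^+ 4.
  by rewrite powRN /y expr_div_n powR_quarter_expr// powR_eighth_expr.
rewrite CE in tcK *.
(* [y ^+ 4] is the smallness parameter. The upper bound on [Rp] says exactly that [(1 + 2 * Rp) * y]
   is at most 1/4, whence 1/256 after taking fourth powers. *)
have Fy : (1 + 2 * Rp) * y <= 4^-1.
  have -> : 4^-1 = (1 + 2 * (a / (2 ^+ 3 * k) - 1 / 2)) * y.
    by rewrite /y; field; rewrite !gt_eqF.
  by apply: ler_wpM2r; [exact: ltW|rewrite /a /k; lra].
have solP f : solution f <-> [/\ measurable3 f,
    forall t x v, `|f t x v - weight alpha beta t x v|
      <= 2 * Rp * weight alpha beta t x v & duhamel f0 f = f].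
  exact: mild_solution_near_maxwellianP.
have F0 : 0 <= 1 + 2 * Rp by lra.
split.
  have [|f [fs funiq]] := @unique_mild_solution R alpha beta Rp f0 a0 b0 Rp6 _ f0M f0near.
    apply: (@le_trans _ _ (y ^+ 4 * (1 + 2 * Rp) ^+ 4)).
      by rewrite ler_wpM2r// exprn_ge0.
    rewrite -exprMn mulrC (_ : 256^-1 = 4^-1 ^+ 4); last by field.
    by apply: lerXn2r => //; rewrite nnegrE ?invr_ge0//; apply: mulr_ge0 => //; exact: ltW.
  exists f; split; first exact/solP.
  by move=> g /solP; exact: funiq.
move=> y12 f /solP[_ fW _] t x v.
(* The lower threshold is the fourth power of 1/8; with [y] above 1/8, the bound [Fy] gives
   [2 * Rp <= 1]. *)
have y8 : 8^-1 < y.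
  rewrite -(@ltr_pXn2r _ 4)// ?nnegrE ?(ltW y0)//.
  by rewrite (_ : 8^-1 ^+ 4 = 1 / 2 ^+ 12)//; field.
have Rp1 : 2 * Rp <= 1.
  have : (1 + 2 * Rp) * 8^-1 <= 4^-1.
    by apply: le_trans Fy; rewrite ler_wpM2l// ltW.
  lra.
have w0 : 0 <= weight alpha beta t x v by exact: expR_ge0.
have := fW t x v; rewrite ler_distl => /andP[+ _]; apply: le_trans.
by rewrite subr_ge0 ler_piMl.
Qed.
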